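(* Let $A_\Gamma$ be an Artin group such that the intersection of any two parabolic subgroups of $A_\Gamma$ is a parabolic subgroup of $A_\Gamma$ (i.e. $A_\Gamma$ is in the class $\mathcal{A}$), and let $H\subset A_\Gamma$ be a subgroup. If $H$ is an $\mathrm{F}\mathcal{A}'$-group, then $H$ is contained in a complete parabolic subgroup of $A_\Gamma$.
   Context: Let $\Gamma$ be a finite non-empty simplicial graph with vertex set $V(\Gamma)$, edge set $E(\Gamma)$ and an edge-labeling $m\colon E(\Gamma)\to\{2,3,4,\ldots\}$. The Artin group $A_\Gamma$ is the group with generating set $V(\Gamma)$ and relations $vwv\cdots = wvw\cdots$ (both sides alternating words with $m(\{v,w\})$ letters) for each $\{v,w\}\in E(\Gamma)$. For $X\subset V(\Gamma)$, $A_X$ denotes the subgroup of $A_\Gamma$ generated by $X$ (trivial if $X=\emptyset$). A parabolic subgroup of $A_\Gamma$ is a conjugate $gA_Xg^{-1}$ with $g\in A_\Gamma$, $X\subset V(\Gamma)$. It is called complete if $X$ can be chosen free of infinity, i.e. $\{v,w\}\in E(\Gamma)$ for all distinct $v,w\in X$. A group $G$ is an $\mathrm{F}\mathcal{A}'$-group if every simplicial action of $G$ on a tree without inversion is locally elliptic, i.e. every element of $G$ has a fixed point in the tree. *)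

(* Defs.v *)
From HB Require Import structures.
From mathcomp Require Import all_boot.
From mathcomp Require Import boolp classical_sets.

Set Implicit Arguments.
Unset Strict Implicit.
Unset Printing Implicit Defensive.

Local Open Scope classical_set_scope.
Local Open Scope group_scope.
Local Open Scope quotient_scope.

(* Words in X and its formal inverses: (x, false) stands for x and (x, true)
   for x^-1. *)
Definition word (X : choiceType) := seq (X * bool).

(* The congruence on words whose classes are the elements of <X | R>. *)
Inductive word_eq (X : choiceType) (R : word X -> word X -> Prop) :
    word X -> word X -> Prop :=
| word_eq_refl u : word_eq R u u
| word_eq_sym u v : word_eq R u v -> word_eq R v u
| word_eq_trans u v w : word_eq R u v -> word_eq R v w -> word_eq R u w
| word_eq_cat u u' v v' :
    word_eq R u u' -> word_eq R v v' -> word_eq R (u ++ v) (u' ++ v')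
| word_eq_cancel x b : word_eq R [:: (x, b); (x, ~~ b)] [::]
| word_eq_rel u v : R u v -> word_eq R u v.

Section PresentedGroup.
Variables (X : choiceType) (R : word X -> word X -> Prop).
Implicit Types u v w : word X.

Definition word_eqb u v : bool := `[< word_eq R u v >].

Lemma word_eqb_refl : reflexive word_eqb.
Proof. by move=> u; apply/asboolP; exact: word_eq_refl. Qed.

Lemma word_eqb_sym : symmetric word_eqb.
Proof.
by move=> u v; apply/idP/idP => /asboolP uv; apply/asboolP/word_eq_sym.
Qed.

Lemma word_eqb_trans : transitive word_eqb.
Proof.
move=> v u w /asboolP uv /asboolP vw.
by apply/asboolP; exact: word_eq_trans uv vw.
Qed.

Canonical word_equiv :=
  EquivRel word_eqb word_eqb_refl word_eqb_sym word_eqb_trans.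

Definition presented_group := {eq_quot word_equiv}.

HB.instance Definition _ := Choice.on presented_group.

Definition word_inv u : word X := rev [seq (a.1, ~~ a.2) | a <- u].

Definition presented_class u : presented_group := \pi_({eq_quot word_equiv}) u.

Lemma presented_classP u v :
  presented_class u = presented_class v <-> word_eq R u v.
Proof.
split; first by move/eqmodP/asboolP.
by move=> uv; apply/eqmodP/asboolP.
Qed.

Lemma presented_reprK (a : presented_group) : presented_class (repr a) = a.
Proof. exact: reprK. Qed.

Lemma word_invK : involutive word_inv.
Proof.
move=> u; rewrite /word_inv map_rev revK -map_comp -[RHS]map_id.
by apply: eq_map => -[x b] /=; rewrite negbK.
Qed.

Lemma word_inv_cat u v : word_inv (u ++ v) = word_inv v ++ word_inv u.
Proof. by rewrite /word_inv map_cat rev_cat. Qed.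

Lemma word_eq_invr u : word_eq R (u ++ word_inv u) [::].
Proof.
elim: u => [|[x b] u IHu]; first exact: word_eq_refl.
rewrite -cat1s word_inv_cat -catA (catA u).
apply: (@word_eq_trans _ _ _ ([:: (x, b)] ++ ([::] ++ [:: (x, ~~ b)]))).
  by do 2?[apply: word_eq_cat => //; try exact: word_eq_refl].
exact: word_eq_cancel.
Qed.

Lemma word_eq_invl u : word_eq R (word_inv u ++ u) [::].
Proof. by rewrite -{2}[u]word_invK; exact: word_eq_invr. Qed.

Lemma word_eq_inv u v : word_eq R u v -> word_eq R (word_inv u) (word_inv v).
Proof.
move=> uv; apply: (@word_eq_trans _ _ _ (word_inv u ++ (v ++ word_inv v))).
  rewrite -{1}[word_inv u]cats0; apply: word_eq_cat; first exact: word_eq_refl.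
  exact/word_eq_sym/word_eq_invr.
rewrite catA -{2}[word_inv v]cat0s.
apply: word_eq_cat; last exact: word_eq_refl.
apply: word_eq_trans (word_eq_invl u).
by apply: word_eq_cat; [exact: word_eq_refl | exact: word_eq_sym].
Qed.

Definition presented_mul (a b : presented_group) : presented_group :=
  presented_class (repr a ++ repr b).
Definition presented_inv (a : presented_group) : presented_group :=
  presented_class (word_inv (repr a)).
Definition presented_one : presented_group := presented_class [::].

Lemma word_eq_repr u : word_eq R (repr (presented_class u)) u.
Proof. by apply/presented_classP; rewrite presented_reprK. Qed.

Lemma presented_mulE u v :
  presented_mul (presented_class u) (presented_class v) =
  presented_class (u ++ v).
Proof. by apply/presented_classP/word_eq_cat; exact: word_eq_repr. Qed.

Lemma presented_invE u :
  presented_inv (presented_class u) = presented_class (word_inv u).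
Proof. by apply/presented_classP/word_eq_inv/word_eq_repr. Qed.

Lemma presented_mulA : associative presented_mul.
Proof.
move=> a b c; rewrite -(presented_reprK a) -(presented_reprK b).
by rewrite -(presented_reprK c) !presented_mulE catA.
Qed.

Lemma presented_mul1 : left_id presented_one presented_mul.
Proof. by move=> a; rewrite -(presented_reprK a) presented_mulE. Qed.

Lemma presented_mulr1 : right_id presented_one presented_mul.
Proof. by move=> a; rewrite -(presented_reprK a) presented_mulE cats0. Qed.

Lemma presented_mulV : left_inverse presented_one presented_inv presented_mul.
Proof.
move=> a; rewrite -(presented_reprK a) presented_invE presented_mulE.
exact/presented_classP/word_eq_invl.
Qed.

Lemma presented_mulrV :
  right_inverse presented_one presented_inv presented_mul.
Proof.
move=> a; rewrite -(presented_reprK a) presented_invE presented_mulE.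
exact/presented_classP/word_eq_invr.
Qed.

HB.instance Definition _ := isGroup.Build presented_group
  presented_mulA presented_mul1 presented_mulr1 presented_mulV presented_mulrV.

End PresentedGroup.

(* Edges are two-element sets of vertices; only the values of label on edges
   are ever used. *)
Record labeled_graph := LabeledGraph {
  vertex : finType;
  edges : {set {set vertex}};
  label : {set vertex} -> nat;
  vertex_gt0 : 0 < #|vertex|;
  edges_card2 : forall d, d \in edges -> #|d| = 2;
  label_ge2 : forall d, d \in edges -> 1 < label d
}.

(* The alternating word v w v ... with n letters. *)
Fixpoint alternating (X : choiceType) (n : nat) (v w : X) : word X :=
  if n is n'.+1 then (v, false) :: alternating n' w v else [::].

Section Artin.
Variable Gamma : labeled_graph.
Implicit Types (v w : vertex Gamma) (X : {set vertex Gamma}).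

Definition artin_rel (r s : word (vertex Gamma)) : Prop :=
  exists v w, [/\ [set v; w]%SET \in edges Gamma,
    r = alternating (label [set v; w]%SET) v w &
    s = alternating (label [set v; w]%SET) w v].

Definition artin_group : groupType := presented_group artin_rel.

Definition artin_gen v : artin_group :=
  presented_class artin_rel [:: (v, false)].

End Artin.

Definition generated (G : groupType) (S : set G) : set G :=
  smallest [set K : set G | group_closed [in K]] S.

Section Parabolic.
Variable Gamma : labeled_graph.
Implicit Types (P : set (artin_group Gamma)) (X : {set vertex Gamma}).

Definition standard_parabolic X : set (artin_group Gamma) :=
  generated [set artin_gen v | v in [set` X]].

Definition free_of_infinity X : Prop :=
  {in X &, forall v w, v != w -> [set v; w]%SET \in edges Gamma}.

Definition parabolic P : Prop :=
  exists g X, P = [set g * x * g^-1 | x in standard_parabolic X].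

Definition complete_parabolic P : Prop :=
  exists g X, free_of_infinity X /\
    P = [set g * x * g^-1 | x in standard_parabolic X].

Definition parabolic_intersection : Prop :=
  forall P Q, parabolic P -> parabolic Q -> parabolic (P `&` Q).

End Parabolic.

Definition is_tree (T : eqType) (adj : rel T) : Prop :=
  [/\ inhabited T, symmetric adj, irreflexive adj,
      forall x y, exists2 p, path adj x p & last x p = y &
      forall c, cycle adj c -> uniq c -> size c <= 2].

Section Actions.
Variables (G : groupType) (T : eqType) (adj : rel T) (act : G -> T -> T).

Definition simplicial_action : Prop :=
  [/\ forall x, act 1 x = x,
      forall g h x, act (g * h) x = act g (act h x) &
      forall g x y, adj (act g x) (act g y) = adj x y].

Definition without_inversion : Prop :=
  forall g x y, adj x y -> ~ (act g x = y /\ act g y = x).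

(* Without inversions, an element fixing a point of the geometric realization
   fixes a vertex, so fixed points are vertices, as in Serre's conventions. *)
Definition locally_elliptic : Prop := forall g, exists x, act g x = x.

End Actions.

Definition FA' (G : groupType) : Prop :=
  forall (T : eqType) (adj : rel T) (act : G -> T -> T),
    is_tree adj -> simplicial_action adj act -> without_inversion adj act ->
    locally_elliptic act.

(* A subgroup H of G (a groupClosed predicate) as a group in its own right. *)
Section SubgroupType.
Variables (G : groupType) (H : groupClosed G).

Definition subgroup : Type := {x : G | x \in H}.

HB.instance Definition _ := SubChoice.on subgroup.
Lemma subgroup_closed : group_closed H.
Proof.
split; first exact: gpred1.
by move=> x y Hx Hy; exact: gpredF.
Qed.
HB.instance Definition _ :=
  SubChoice_isSubGroup.Build G [in H] subgroup subgroup_closed.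

End SubgroupType.

(* Main.v *)
From HB Require Import structures.
Require Import Defs.
From mathcomp Require Import all_boot all_algebra all_field.
From mathcomp Require Import ring.
From mathcomp Require Import boolp classical_sets.

(** Let P = a A_X a^-1 be the smallest parabolic subgroup containing H.  It is
    complete, because two non-adjacent vertices v, w of X would split the
    Artin group as an amalgamated product in which H is elliptic but P is not.

    Smallest parabolics exist because of a chain condition: a parabolic
    subgroup contained in b A_X b^-1 has the form k A_Z k^-1 with Z a subset
    of X, and it is the whole of b A_X b^-1 when Z = X
    ([parabolic_sub_standard], [parabolic_sub_card]).  Since parabolic
    subgroups are stable under intersection, every set has a parabolic closure
    ([parabolic_closure]), and the closure of H is the closure of a finite
    part F of H ([finite_parabolic_closure]).

    Now let v, w in X be non-adjacent, and consider the graph of the cosets of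
    A_(V - v) and A_(V - w), where two cosets are adjacent when they meet.  It
    is a tree on which the Artin group acts with parabolic vertex stabilizers.
    The group H acts on it with elliptic elements only, so the finite set F
    fixes a vertex by an argument of Serre ([finite_elliptic_fixpoint]); the
    stabilizer of this vertex is parabolic, hence contains the closure of F,
    which is P.  Therefore the conjugate A_X of P fixes a vertex as well, and
    so does v w.  But v and w fix the two ends of one edge and neither fixes
    the edge, hence v w is hyperbolic ([splitting_product_hyperbolic]).

    The chain condition comes from the retraction of Charney and Paris.  The
    Artin group acts on pairs (w, h), where w is a reduced representative of a
    coset of W_X in the Coxeter group W and h lies in A_X: a generator s
    either moves the coset or, when s w = w x with x in X, fixes it and
    multiplies h by x.  An element of A_X sends (1, 1) to (1, itself).  If
    a A_Y a^-1 is contained in A_X, and a^-1 sends (1, 1) to (w, h), then each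
    s in Y must fix the coset of w, which expresses a s a^-1 as h^-1 x h for
    some x in X.  The braid relations for this action rest on the permutation
    of roots by W (a root is a reflection with a sign), and on the fact that
    the product of two Coxeter generators has exactly the order prescribed by
    the graph, which is read off a reflection representation.

    That the coset graph has no cycle is a cohomological statement: there is a
    function on its vertices, with values in the mod 2 chains of edges, whose
    coboundary on each edge is that edge ([splitting_potential]).  It is
    obtained by letting A_(V - v) act linearly on chains and A_(V - w) act by
    conjugates of the linear action under a translation; the two recipes agree
    on common generators, and every edge of the graph avoids v or w, so that
    all braid relations hold. *)

Set Implicit Arguments.
Unset Strict Implicit.
Unset Printing Implicit Defensive.

Import GRing.Theory Num.Theory.
Local Open Scope classical_set_scope.
Local Open Scope group_scope.

(** * Subgroups, conjugates and actions of presented groups *)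

Section Subgroups.
Variable G : groupType.
Implicit Types (K S : set G) (g x y : G).

Definition is_subgroup K :=
  [/\ K 1, forall x y, K x -> K y -> K (x * y) & forall x, K x -> K x^-1].

Lemma is_subgroupP K : group_closed [in K] <-> is_subgroup K.
Proof.
split=> [clK|[K1 KM KV]].
  split; first by have [] := clK; rewrite inE.
    by move=> x y Kx Ky; have := group_closedM clK; move/(_ x y); rewrite !inE; apply.
  by move=> x Kx; have := group_closedV clK; move/(_ x); rewrite !inE; apply.
split; first by rewrite inE.
by move=> x y; rewrite !inE => Kx Ky; apply: KM => //; apply: KV.
Qed.

Lemma generated_min K S : is_subgroup K -> S `<=` K -> generated S `<=` K.
Proof. by move=> /is_subgroupP clK SK; apply: smallest_sub. Qed.

Lemma sub_generated S : S `<=` generated S.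
Proof. exact: sub_gen_smallest. Qed.

Lemma generated_subgroup S : is_subgroup (generated S).
Proof.
split.
- by move=> K [/is_subgroupP[]].
- move=> x y Sx Sy K clSK; have [/is_subgroupP[_ KM _] _] := clSK.
  by apply: KM; [exact: Sx | exact: Sy].
- move=> x Sx K clSK; have [/is_subgroupP[_ _ KV] _] := clSK.
  by apply: KV; exact: Sx.
Qed.

Definition conjs g K : set G := [set g * x * g^-1 | x in K].

Lemma conjsP g K y : conjs g K y <-> K (g^-1 * y * g).
Proof.
split=> [[x Kx <-]|Ky]; first by rewrite !mulgA mulVg mul1g mulgVK.
by exists (g^-1 * y * g); rewrite // !mulgA mulgV mul1g mulgK.
Qed.

Lemma conjs_subgroup g K : is_subgroup K -> is_subgroup (conjs g K).
Proof.
case=> K1 KM KV; split.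
- by apply/conjsP; rewrite mulg1 mulVg.
- move=> x y /conjsP Kx /conjsP Ky; apply/conjsP.
  by have := KM _ _ Kx Ky; rewrite !mulgA mulgK.
- move=> x /conjsP/KV Kx; apply/conjsP; move: Kx.
  by rewrite !invgM invgK mulgA.
Qed.

Lemma conjsM g h K : conjs g (conjs h K) = conjs (g * h) K.
Proof.
apply/seteqP; split=> x.
  by move=> /conjsP/conjsP Kx; apply/conjsP; move: Kx; rewrite invgM !mulgA.
by move=> /conjsP Kx; apply/conjsP/conjsP; move: Kx; rewrite invgM !mulgA.
Qed.

Lemma conjs1 K : conjs 1 K = K.
Proof.
by apply/seteqP; split=> x; [move=> /conjsP | move=> Kx; apply/conjsP; move: Kx];
  rewrite invg1 mul1g mulg1.
Qed.

Lemma conjs_sub g K1 K2 : (conjs g K1 `<=` K2) <-> (K1 `<=` conjs g^-1 K2).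
Proof.
split=> sK x.
  by move=> Kx; apply/conjsP; rewrite invgK; apply: sK; exists x.
by move=> /conjsP/sK/conjsP; rewrite invgK !mulgA mulgV mul1g mulgK.
Qed.

Lemma conjs_mem g K : is_subgroup K -> K g -> conjs g K = K.
Proof.
move=> [K1 KM KV] Kg; apply/seteqP; split=> x.
  by move=> [y Ky <-]; apply: (KM); [exact: KM | exact: KV].
by move=> Kx; apply/conjsP; apply: (KM) => //; apply: KM => //; exact: KV.
Qed.

Lemma conjs_generated g S : conjs g (generated S) = generated (conjs g S).
Proof.
apply/seteqP; split.
  apply: (conjs_sub _ _ _).2; apply: generated_min.
    exact/conjs_subgroup/generated_subgroup.
  move=> x Sx; apply/(conjsP _ _ _).2; rewrite invgK; apply: sub_generated; by exists x.
apply: generated_min; first exact/conjs_subgroup/generated_subgroup.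
move=> _ [x Sx <-]; exists x => //; exact: sub_generated.
Qed.

End Subgroups.

Section PresentedAction.
Variables (X : choiceType) (R : word X -> word X -> Prop).
Variables (S : Type) (C : set S) (f : X -> bool -> S -> S).

Definition word_act (r : word X) (s : S) : S :=
  foldr (fun a => f a.1 a.2) s r.

Lemma word_act_cat r1 r2 s : word_act (r1 ++ r2) s = word_act r1 (word_act r2 s).
Proof. by rewrite /word_act foldr_cat. Qed.

(** The invariant set C leaves room for steps that obey the relations on part
    of S only, as those of the retraction do. *)
Definition presents_action : Prop :=
  [/\ forall x b s, C s -> C (f x b s),
      forall x b s, C s -> f x b (f x (~~ b) s) = s &
      forall r1 r2, R r1 r2 -> forall s, C s -> word_act r1 s = word_act r2 s].

Definition presented_act (g : presented_group R) : S -> S := word_act (repr g).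

Hypothesis f_acts : presents_action.

Lemma word_act_closed r s : C s -> C (word_act r s).
Proof. by have [f_closed _ _] := f_acts; elim: r => //= a r IHr /IHr; exact: f_closed. Qed.

Lemma word_eq_act r1 r2 : word_eq R r1 r2 ->
  forall s, C s -> word_act r1 s = word_act r2 s.
Proof.
have [_ fK f_rel] := f_acts.
elim=> {r1 r2} [//|r1 r2 _ IH s Cs|r1 r2 r3 _ IH12 _ IH23 s Cs
  |r1 r1' r2 r2' _ IH1 _ IH2 s Cs|x b s Cs|r1 r2 /f_rel//].
- by rewrite IH.
- by rewrite IH12 ?IH23.
- by rewrite !word_act_cat IH2 // IH1 //; exact: word_act_closed.
- exact: fK.
Qed.

Lemma presented_act_class r s : C s ->
  presented_act (presented_class R r) s = word_act r s.
Proof. by apply: word_eq_act; exact: word_eq_repr. Qed.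

Lemma presented_act_gen x s : C s ->
  presented_act (presented_class R [:: (x, false)]) s = f x false s.
Proof. exact: presented_act_class. Qed.

Lemma presented_act_closed g s : C s -> C (presented_act g s).
Proof. exact: word_act_closed. Qed.

Lemma presented_act1 s : C s -> presented_act 1 s = s.
Proof. exact: (@presented_act_class [::]). Qed.

Lemma presented_actM g h s : C s ->
  presented_act (g * h) s = presented_act g (presented_act h s).
Proof.
move=> Cs; have -> : g * h = presented_class R (repr g ++ repr h) by [].
by rewrite presented_act_class // word_act_cat.
Qed.

End PresentedAction.

Section PresentedGenerators.
Variables (X : choiceType) (R : word X -> word X -> Prop).

Lemma presented_class_cat r1 r2 :
  presented_class R (r1 ++ r2) = presented_class R r1 * presented_class R r2.
Proof. by rewrite -[RHS]/(presented_mul _ _) presented_mulE. Qed.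

Lemma presented_class_inv x :
  presented_class R [:: (x, true)] = (presented_class R [:: (x, false)])^-1.
Proof. by rewrite -[RHS]/(presented_inv _) presented_invE. Qed.

Lemma presented_ind (K : set (presented_group R)) :
  is_subgroup K -> (forall x, K (presented_class R [:: (x, false)])) -> forall g, K g.
Proof.
case=> K1 KM KV Kgen g; rewrite -(presented_reprK g).
elim: (repr g) => [|[x b] r IHr]; first exact: K1.
rewrite -cat1s presented_class_cat; apply: (KM) => //.
by case: b; rewrite ?presented_class_inv; [apply: KV|].
Qed.

End PresentedGenerators.

(** * The Coxeter group and its roots *)

Section Alternating.
Variable W : groupType.
Implicit Types (u v t z : W) (n k : nat).

Fixpoint alt n u v : W := if n is n'.+1 then u * alt n' v u else 1.

Lemma expg_swap n u v : u * (v * u) ^+ n = (u * v) ^+ n * u.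
Proof. by elim: n => [|n IHn]; rewrite ?mulg1 ?mul1g // !expgS -!mulgA IHn. Qed.

Lemma involV z : z * z = 1 -> z^-1 = z.
Proof. by move=> zz; rewrite -[LHS]mulg1 -zz mulKg. Qed.

(** For involutions the braid relation of length n thus amounts to
    (u v)^n = 1. *)
Lemma alt_divE n u v : u * u = 1 -> v * v = 1 ->
  alt n u v * (alt n v u)^-1 = (u * v) ^+ n.
Proof.
elim: n u v => [|n IHn] u v uu vv /=; first by rewrite invg1 mulg1.
rewrite invgM mulgA -(mulgA u) IHn // expg_swap (involV vv).
by rewrite -mulgA -expgSr.
Qed.

(** The word u v u ... of length n is read from its last letter on, and t is
    conjugated by each letter in turn; hits counts the letters that are met by
    their own value.  This is the number of sign changes of the root of t. *)
Fixpoint hits n u v t : nat :=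
  if n is n'.+1 then
    hits n' v u t + (alt n' v u * t * (alt n' v u)^-1 == u) else 0.

(** At k = 0 the left-hand side is the only t for which the first of n + 1
    alternating letters is a hit.  The exponent k is there for the induction,
    which absorbs the innermost conjugating letter into the power, by
    v (u v)^k u v = (v u)^(k+1) v. *)
Lemma alt_reflection n k u v : u * u = 1 -> v * v = 1 ->
  let z := if odd n then v else u in let z' := if odd n then u else v in
  (alt n v u)^-1 * ((u * v) ^+ k * u) * alt n v u = (z * z') ^+ (k + n) * z.
Proof.
move=> uu vv /=; elim: n k u v uu vv => [|n IHn] k u v uu vv /=.
  by rewrite invg1 mul1g mulg1 addn0.
have := IHn k.+1 v u vv uu; rewrite addSnnS expgS -(mulgA v u) expg_swap.
by case: (odd n) => /= <-; rewrite invgM (involV vv) !mulgA.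
Qed.

Lemma conjg_eq a t u : (a * t * a^-1 == u) = (t == a^-1 * u * a).
Proof.
apply/eqP/eqP => [<-|->]; first by rewrite !mulgA mulVg mul1g mulgVK.
by rewrite !mulgA mulgV mul1g mulgK.
Qed.

Lemma hits_sum n u v t : u * u = 1 -> v * v = 1 ->
  let z := if odd n then u else v in let z' := if odd n then v else u in
  hits n u v t = (\sum_(i < n) (t == ((z * z') ^+ i * z)%g))%N.
Proof.
move=> + + /=; elim: n u v => [|n IHn] u v uu vv /=; first by rewrite big_ord0.
rewrite big_ord_recr /= IHn //; have := alt_reflection n 0 uu vv.
rewrite mul1g add0n /= conjg_eq => ->.
by case: (odd n).
Qed.

(** The n reflections that are hit along u v u ... are those hit along
    v u v ..., in the opposite order, so both sides of a braid relation have
    the same effect on signs. *)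
Lemma hits_sym n u v t : u * u = 1 -> v * v = 1 -> alt n u v = alt n v u ->
  hits n u v t = hits n v u t.
Proof.
move=> uu vv E; rewrite !hits_sum //.
have uvn : (u * v) ^+ n = 1 by rewrite -alt_divE // E mulgV.
have vun : (v * u) ^+ n = 1 by rewrite -alt_divE // E mulgV.
suff H a b : a * a = 1 -> b * b = 1 -> (a * b) ^+ n = 1 ->
    (\sum_(i < n) (t == ((a * b) ^+ i * a)%g) = \sum_(i < n) (t == ((b * a) ^+ i * b)%g))%N.
  by case: (odd n); apply: H.
move=> aa bb abn; rewrite (reindex_inj rev_ord_inj) /=; apply: eq_bigr => i _.
congr (nat_of_bool (t == _)).
have abV : (a * b)^-1 = b * a by rewrite invgM (involV aa) (involV bb).
rewrite -abV; apply: (mulIg b); rewrite -(mulgA _ b) bb mulg1.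
rewrite -mulgA -expgSr subnSK //.
apply: (mulgI ((a * b) ^+ i)); rewrite -expgnDr subnKC ?abn; last exact: ltnW.
by rewrite expVgn mulgV.
Qed.

End Alternating.

Section Coxeter.
Variable Gamma : labeled_graph.
Implicit Types (u v x y s : vertex Gamma) (X J : {set vertex Gamma}).

Definition coxeter_rel (r1 r2 : word (vertex Gamma)) : Prop :=
  artin_rel r1 r2 \/ exists v, r1 = [:: (v, false); (v, false)] /\ r2 = [::].

Definition coxeter_group : groupType := presented_group coxeter_rel.

Definition coxeter_gen v : coxeter_group :=
  presented_class coxeter_rel [:: (v, false)].

Local Notation W := coxeter_group.
Local Notation c := coxeter_gen.
Implicit Types (w t d : W).

Lemma coxeter_genK v : c v * c v = 1.
Proof.
rewrite -presented_class_cat; apply/presented_classP/word_eq_rel.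
by right; exists v.
Qed.

Lemma coxeter_genV v : (c v)^-1 = c v.
Proof. exact/involV/coxeter_genK. Qed.

Lemma alternating_class (R : word (vertex Gamma) -> word (vertex Gamma) -> Prop) n u v :
  presented_class R (alternating n u v) =
  alt n (presented_class R [:: (u, false)] : presented_group R)
        (presented_class R [:: (v, false)]).
Proof.
elim: n u v => [//|n IHn] u v.
by rewrite -[alternating _ _ _]/([:: (u, false)] ++ alternating n v u)
  presented_class_cat IHn.
Qed.

Lemma edge_neq u v : [set u; v]%SET \in edges Gamma -> u != v.
Proof. by move/edges_card2; rewrite cards2; case: eqP. Qed.

Lemma coxeter_braid u v : [set u; v]%SET \in edges Gamma ->
  let m := label [set u; v]%SET in alt m (c u) (c v) = alt m (c v) (c u).
Proof.
move=> Euv m; rewrite -!alternating_class; apply/presented_classP/word_eq_rel.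
by left; exists u, v.
Qed.

(** The root of the reflection t, positive when the boolean is false.  The
    generator v changes the sign of its own root and of no other.  Elements t
    that are not conjugate to a generator never change sign, hence do no
    harm. *)
Definition root_step v (b : bool) (r : W * bool) : W * bool :=
  (c v * r.1 * c v, r.2 (+) (r.1 == c v)).

Lemma root_step_alt n u v t e :
  word_act root_step (alternating n u v) (t, e) =
  (alt n (c u) (c v) * t * (alt n (c u) (c v))^-1,
   e (+) odd (hits n (c u) (c v) t)).
Proof.
elim: n u v => [|n IHn] u v /=; first by rewrite mul1g invg1 mulg1 addbF.
rewrite IHn /root_step /= invgM coxeter_genV !mulgA oddD -addbA.
by congr (_, _ (+) (_ (+) _)); case: eqP.
Qed.

Definition root_act : W -> W * bool -> W * bool :=
  presented_act (R := coxeter_rel) root_step.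

Lemma root_stepK x b r : root_step x b (root_step x (~~ b) r) = r.
Proof.
case: r => t e; rewrite /root_step /= !mulgA coxeter_genK mul1g -!mulgA coxeter_genK mulg1.
have -> : (c x * (t * c x) == c x) = (t == c x).
  by rewrite -{2}(coxeter_genV x) mulgA conjg_eq mulVg mul1g.
by rewrite -addbA addbb addbF.
Qed.

Lemma root_step_acts : presents_action coxeter_rel setT root_step.
Proof.
split=> // [x b r _|r1 r2]; first exact: root_stepK.
case=> [[u [v [Euv -> ->]]]|[v [-> ->]]] [t e] _; last exact: (root_stepK v false).
by rewrite !root_step_alt (coxeter_braid Euv) (hits_sym _ _ _ (coxeter_braid Euv))
  ?coxeter_genK.
Qed.

Lemma root_actM w1 w2 r : root_act (w1 * w2) r = root_act w1 (root_act w2 r).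
Proof. exact: (presented_actM root_step_acts). Qed.

Lemma root_act1 r : root_act 1 r = r.
Proof. exact: (presented_act1 root_step_acts). Qed.

Lemma root_act_gen v r : root_act (c v) r = root_step v false r.
Proof. exact: (presented_act_gen root_step_acts). Qed.

(** True when w sends the positive root of t to a negative root. *)
Definition flip w t : bool := (root_act w (t, false)).2.

Lemma coxeter_ind (K : W -> Prop) : K 1 -> (forall v w, K w -> K (c v * w)) -> forall w, K w.
Proof.
move=> K1 KM w; rewrite -(presented_reprK w).
elim: (repr w) => [//|[x b] r /(KM x)].
rewrite -cat1s presented_class_cat; case: b => //.
by rewrite presented_class_inv -[X in X^-1]/(c x) coxeter_genV.
Qed.

Lemma root_actE w t e : root_act w (t, e) = (w * t * w^-1, e (+) flip w t).
Proof.
rewrite /flip; elim/coxeter_ind: w t e => [|v w IHw] t e.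
  by rewrite !root_act1 mul1g invg1 mulg1 addbF.
rewrite !root_actM (IHw t e) (IHw t false) !root_act_gen /root_step /=.
by rewrite addbA invgM coxeter_genV !mulgA.
Qed.

Lemma flipM w1 w2 t : flip (w1 * w2) t = flip w2 t (+) flip w1 (w2 * t * w2^-1).
Proof. by rewrite {1}/flip root_actM !root_actE. Qed.

Lemma flip1 t : flip 1 t = false.
Proof. by rewrite /flip root_act1. Qed.

Lemma flip_gen v t : flip (c v) t = (t == c v).
Proof. by rewrite /flip root_act_gen. Qed.

Lemma coxeter_gen_neq1 v : c v != 1.
Proof.
by apply/eqP => cv1; have := flip_gen v (c v); rewrite eqxx {1}cv1 flip1.
Qed.

Definition coxeter_prod (q : seq (vertex Gamma)) : W := \prod_(v <- q) c v.

Lemma coxeter_prod_cat q1 q2 : coxeter_prod (q1 ++ q2) = coxeter_prod q1 * coxeter_prod q2.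
Proof. by rewrite /coxeter_prod big_cat. Qed.

Lemma coxeter_prod_cons v q : coxeter_prod (v :: q) = c v * coxeter_prod q.
Proof. by rewrite /coxeter_prod big_cons. Qed.

Lemma coxeter_prod_rcons v q : coxeter_prod (rcons q v) = coxeter_prod q * c v.
Proof. by rewrite -cats1 coxeter_prod_cat /coxeter_prod big_seq1. Qed.

Lemma coxeter_prod_rev q : coxeter_prod (rev q) = (coxeter_prod q)^-1.
Proof.
elim: q => [|v q IHq]; first by rewrite /coxeter_prod big_nil invg1.
by rewrite rev_cons coxeter_prod_rcons coxeter_prod_cons IHq invgM coxeter_genV.
Qed.

Lemma coxeter_prodP w : exists q, w = coxeter_prod q.
Proof.
elim/coxeter_ind: w => [|v w [q ->]]; first by exists [::]; rewrite /coxeter_prod big_nil.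
by exists (v :: q); rewrite coxeter_prod_cons.
Qed.

(** Some letter of the word changes the sign of the root of t; deleting this
    letter gives a word for the product with t. *)
Lemma strong_exchange q t : flip (coxeter_prod q) t ->
  exists q', [/\ size q' < size q, {subset q' <= q} & coxeter_prod q * t = coxeter_prod q'].
Proof.
elim: q => [|v q IHq]; first by rewrite /coxeter_prod big_nil flip1.
rewrite coxeter_prod_cons flipM flip_gen; have [ft|_ /=] := boolP (flip (coxeter_prod q) t).
  have [q' [sq' subq' E]] := IHq ft.
  move=> _; exists (v :: q'); split; [exact: sq'| | by rewrite -mulgA E coxeter_prod_cons].
  by move=> x; rewrite !inE => /orP[->//|/subq' ->]; rewrite orbT.
move=> /eqP E; exists q; split; [exact: leqnn | | ].
  by move=> x xq; rewrite inE xq orbT.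
have Et : coxeter_prod q * t = c v * coxeter_prod q by rewrite -E mulgVK.
by rewrite -mulgA Et mulgA coxeter_genK mul1g.
Qed.

Definition coxeter_sub J : set W :=
  [set w | exists2 q, {subset q <= J} & w = coxeter_prod q].

Lemma coxeter_sub_subgroup J : is_subgroup (coxeter_sub J).
Proof.
split.
- by exists [::]; rewrite // /coxeter_prod big_nil.
- move=> _ _ [q1 s1 ->] [q2 s2 ->]; exists (q1 ++ q2); last by rewrite coxeter_prod_cat.
  by move=> x; rewrite mem_cat => /orP[/s1|/s2].
- move=> _ [q s ->]; exists (rev q); last by rewrite coxeter_prod_rev.
  by move=> x; rewrite mem_rev => /s.
Qed.

Lemma coxeter_sub_gen J v : v \in J -> coxeter_sub J (c v).
Proof.
move=> vJ; exists [:: v]; last by rewrite /coxeter_prod big_seq1.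
by move=> x; rewrite inE => /eqP->.
Qed.

(** If s is the last letter of a word for d, then the other letters together
    make the root of s negative, because d keeps it positive; by exchange d
    has a shorter word. *)
Lemma parabolic_reduced_eq1 J d :
  coxeter_sub J d -> (forall s, s \in J -> flip d (c s) = false) -> d = 1.
Proof.
case=> q; have [n] := ubnP (size q); elim: n q => // n IHn q.
case/lastP: q => [|q s]; first by rewrite /coxeter_prod big_nil.
rewrite size_rcons ltnS => sq subq dE dpos.
have sJ : s \in J by apply: subq; rewrite mem_rcons inE eqxx.
have := dpos _ sJ; rewrite dE coxeter_prod_rcons flipM flip_gen eqxx mulgK.
move/negbFE/strong_exchange => [q' [sq' subq' E]].
rewrite -coxeter_prod_rcons -dE; apply: (IHn q') => //.
- exact: leq_trans sq' (ltnW sq).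
- by move=> x /subq' xq; apply: subq; rewrite mem_rcons inE xq orbT.
- by rewrite dE coxeter_prod_rcons.
Qed.

(** A shortest element of the coset of w^-1 keeps the sign of all reflections
    of W_J: strong exchange would turn a sign change into a shorter element of
    the same coset. *)
Lemma min_coset_rep J w : exists d w', [/\ coxeter_sub J d, w = d * w' &
  forall t, coxeter_sub J t -> flip w'^-1 t = false].
Proof.
have [W1 WM WV] := coxeter_sub_subgroup J.
pose P n := `[< exists q d, [/\ size q = n, coxeter_sub J d & w^-1 * d = coxeter_prod q] >].
have exP : exists n, P n.
  have [q qE] := coxeter_prodP w^-1.
  by exists (size q); apply/asboolP; exists q, 1; rewrite mulg1.
case: (ex_minnP exP) => n /asboolP [q [d [<- Jd E]]] minq.
exists d, (d^-1 * w); split=> //; first by rewrite mulVKg.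
move=> t Jt; rewrite invgM invgK E; apply/negP => /strong_exchange[q' [sq' _ E']].
suff /minq : P (size q') by rewrite leqNgt sq'.
apply/asboolP; exists q', (d * t); split=> //; first exact: WM.
by rewrite mulgA E.
Qed.

(** The element g = w' x w'^-1 of W_J is not trivial, so it makes the root of
    some s in J negative.  As w'^-1 preserves signs on W_J, it is x that
    changes the sign of the root of w'^-1 s w', and x changes only its own. *)
Lemma reduced_conj_simple J w w' d x : coxeter_sub J d -> w = d * w' ->
  (forall t, coxeter_sub J t -> flip w'^-1 t = false) ->
  coxeter_sub J (w * c x * w^-1) ->
  exists2 s, s \in J & w' * c x * w'^-1 = c s.
Proof.
move=> Jd -> w'min; have [W1 WM WV] := coxeter_sub_subgroup J.
set g := w' * c x * w'^-1 => Jx.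
have Jg : coxeter_sub J g.
  have := WM _ _ (WM _ _ (WV _ Jd) Jx) Jd.
  by rewrite invgM !mulgA mulVg mul1g -!mulgA mulVg mulg1 !mulgA.
have [s sJ fs] : exists2 s, s \in J & flip g (c s).
  apply: contrapT => nos; have /eqP : g = 1.
    apply: (parabolic_reduced_eq1 Jg) => s sJ; apply/negP => fs; apply: nos; by exists s.
  rewrite /g -(inj_eq (mulIg w')) mul1g mulgVK -{2}[w']mulg1 (inj_eq (mulgI _)).
  by apply/negP/coxeter_gen_neq1.
exists s => //; have : flip (w'^-1 * g) (c s).
  rewrite flipM fs w'min //; apply: (WM); last exact: WV.
  by apply: WM => //; exact: coxeter_sub_gen.
rewrite /g !mulgA mulVg mul1g flipM w'min ?flip_gen; last exact: coxeter_sub_gen.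
by rewrite invgK => /= /eqP <-; rewrite !mulgA mulgV mul1g mulgK.
Qed.

End Coxeter.

(** * Orders of products of two Coxeter generators *)

Section ReflectionRepresentation.
Local Open Scope ring_scope.
Variable Gamma : labeled_graph.
Implicit Types (u v x y s : vertex Gamma).

Variables (F : numFieldType) (zeta : nat -> F).
Hypothesis zetaP : forall m, (0 < m)%N -> (m.*2).-primitive_root (zeta m).

Implicit Types f : vertex Gamma -> F.

(** Up to a Galois conjugation this is 2 cos (pi / m) on an edge of label m,
    that is -2 times the entry of the Tits form. *)
Definition bond u v : F :=
  let z := zeta (label [set u; v]%SET) in
  if [set u; v]%SET \in edges Gamma then (z + z^-1) else 2%:R.

(** The coordinates of a vector are taken along the simple roots, so that the
    reflection in v changes the coordinate at v only. *)
Definition reflection v (b : bool) f : vertex Gamma -> F :=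
  fun y => if y == v then (\sum_(s | s != v) bond v s * f s - f v) else f y.

Lemma bondC u v : bond u v = bond v u.
Proof. by rewrite /bond finset.setUC. Qed.

Lemma reflectionK x b f : reflection x b (reflection x (~~ b) f) = f.
Proof.
apply/funext => y; rewrite /reflection; case: eqP => [->|//]; rewrite eqxx.
rewrite (eq_bigr (fun s => bond x s * f s)) ?subKr // => s /negPf-> //.
Qed.

Section Pair.
Variables (u v : vertex Gamma).
Hypothesis uv : u != v.

Definition with_pair f (a b : F) : vertex Gamma -> F :=
  fun y => if y == u then a else if y == v then b else f y.

Lemma with_pairE f : with_pair f (f u) (f v) = f.
Proof. by apply/funext => y; rewrite /with_pair; case: eqP => [->|_] //; case: eqP => [->|]. Qed.

(** Reflections in u and v fix the other coordinates, which therefore enter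
    the plane dynamics of the coordinates at u and v as a constant. *)
Definition offset x f : F := (\sum_(s | (s != u) && (s != v)) bond x s * f s).

Lemma reflection_fst f a b e :
  reflection u e (with_pair f a b) = with_pair f (bond u v * b + offset u f - a) b.
Proof.
have vu : v != u by rewrite eq_sym.
apply/funext => y; rewrite /reflection; case: eqP => [->|/eqP yu]; last first.
  by rewrite /with_pair (negPf yu).
rewrite {2 3}/with_pair eqxx; congr (_ - _).
rewrite (bigD1 v) //= /with_pair (negPf vu) eqxx; congr (_ + _).
by apply: eq_bigr => s /andP[/negPf-> /negPf->].
Qed.

Lemma reflection_snd f a b e :
  reflection v e (with_pair f a b) = with_pair f a (bond u v * a + offset v f - b).
Proof.
have vu : v != u by rewrite eq_sym.
apply/funext => y; rewrite /reflection; case: eqP => [->|/eqP yv]; last first.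
  by rewrite /with_pair; case: eqP => // _; rewrite (negPf yv).
rewrite {2 3}/with_pair (negPf vu) eqxx; congr (_ - _).
rewrite (bigD1 u) //= /with_pair eqxx bondC; congr (_ + _).
by apply: eq_big => s; [rewrite andbC | move=> /andP[/negPf-> /negPf->]].
Qed.

(** Without an edge the product of the two reflections is unipotent, of
    infinite order. *)
Lemma iter_reflection_free n :
  [set u; v]%SET \notin edges Gamma ->
  iter n (reflection u false \o reflection v false) (with_pair (fun=> 0) 1 0) =
  with_pair (fun=> 0) (n.*2.+1)%:R (n.*2)%:R.
Proof.
move=> nE; elim: n => [|n IHn]; first by rewrite /=.
rewrite iterS IHn /= reflection_snd reflection_fst /offset /bond (negPf nE).
rewrite !big1 => [|s _|s _]; rewrite ?mulr0 // doubleS.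
rewrite -[n.*2.+3]addn3 -[n.*2.+2]addn2 -[n.*2.+1]addn1 !(natrD _ n.*2).
by congr (with_pair _ _ _); ring.
Qed.

Hypothesis Euv : [set u; v]%SET \in edges Gamma.
Let m := label [set u; v]%SET.
Let z := zeta m.

Let m_gt0 : (0 < m)%N. Proof. exact: ltnW (label_ge2 Euv). Qed.
Let z_prim : (m.*2).-primitive_root z. Proof. exact: zetaP. Qed.
Let z0 : (z != 0).
Proof.
apply/eqP => z0; have /eqP := prim_expr_order z_prim.
by rewrite z0 expr0n double_eq0 (gtn_eqF m_gt0) eq_sym oner_eq0.
Qed.
Let bondE : bond u v = (z + z^-1).
Proof. by rewrite /bond Euv. Qed.
Let z2 : (z ^+ 2 - 1 != 0).
Proof.
rewrite subr_eq0 -(prim_order_dvd z_prim); apply/negP => /dvdn_leq-/(_ isT).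
by rewrite -[X in (_ <= X)%N]/(1.*2)%N leq_double leqNgt (label_ge2 Euv).
Qed.

(** Around a fixed point (p, q) of the affine dynamics, (1, z) and (1, z^-1)
    are eigenvectors of the product of the two reflections. *)
Let spiral f (p q a b : F) :=
  with_pair f (p + a + b) (q + a * z + b / z).

Let spiral_step f p q a b : p *+ 2 = bond u v * q + offset u f ->
  q *+ 2 = bond u v * p + offset v f ->
  reflection u false (reflection v false (spiral f p q a b)) =
  spiral f p q (a / z ^+ 2) (b * z ^+ 2).
Proof.
move=> Ep Eq.
have {}Ep : offset u f = p *+ 2 - bond u v * q by rewrite Ep addrC addKr.
have {}Eq : offset v f = q *+ 2 - bond u v * p by rewrite Eq addrC addKr.
rewrite {1}/spiral reflection_snd reflection_fst Ep Eq bondE /spiral.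
by congr (with_pair _ _ _); field; rewrite z0.
Qed.

Let iter_spiral f p q : p *+ 2 = bond u v * q + offset u f ->
  q *+ 2 = bond u v * p + offset v f ->
  forall n a b, iter n (reflection u false \o reflection v false) (spiral f p q a b) =
    spiral f p q (a / z ^+ (2 * n)) (b * z ^+ (2 * n)).
Proof.
move=> Ep Eq; elim=> [|n IHn] a b; first by rewrite muln0 expr0 invr1 !mulr1.
rewrite iterSr -[(_ \o _) _]/(reflection u false (reflection v false _)).
by rewrite spiral_step // IHn -(mulrA b) -(mulrA a) -invfM -exprD -mulnS.
Qed.

Lemma iter_reflection f : iter m (reflection u false \o reflection v false) f = f.
Proof.
pose c := bond u v.
(* The determinant of the linear system satisfied by a fixed point. *)
have c4 : 4%:R - c ^+ 2 != 0.
  have -> : 4%:R - c ^+ 2 = - ((z ^+ 2 - 1) / z) ^+ 2.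
    by rewrite /c bondE; field; rewrite z0.
  by rewrite oppr_eq0 expf_eq0 /= mulf_eq0 invr_eq0 (negPf z2) (negPf z0).
pose p := (2%:R * offset u f + c * offset v f) / (4%:R - c ^+ 2).
pose q := (2%:R * offset v f + c * offset u f) / (4%:R - c ^+ 2).
have Ep : p *+ 2 = c * q + offset u f by rewrite /p /q; field.
have Eq : q *+ 2 = c * p + offset v f by rewrite /p /q; field.
pose a := ((f v - q) * z - (f u - p)) / (z ^+ 2 - 1).
pose b := ((f u - p) * z - (f v - q)) * z / (z ^+ 2 - 1).
(* Here a and b are the coordinates of f - (p, q) on the two eigenvectors. *)
have -> : f = spiral f p q a b.
  rewrite -[LHS]with_pairE /spiral /a /b; congr (with_pair _ _ _); field => //.
  by rewrite z2 z0.
rewrite -[X in iter X]/m iter_spiral // mul2n (prim_expr_order z_prim).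
by rewrite mulr1 divr1.
Qed.

(** On an eigenvector the product acts by z^-2, whose order is the label. *)
Lemma iter_reflection_order n : (forall f,
  iter n (reflection u false \o reflection v false) f = f) -> (m %| n)%N.
Proof.
move/(_ (spiral (fun=> 0) 0 0 1 0)).
have O x : offset x (fun=> 0) = 0 by rewrite /offset big1 // => s _; rewrite mulr0.
rewrite iter_spiral ?O ?mulr0 ?add0r ?mul0rn // => /(congr1 (fun f => f u)).
rewrite /spiral /with_pair eqxx !mul0r !addr0 !add0r mul1r => /(canRL (@invrK _)).
rewrite invr1 => /eqP; rewrite -(prim_order_dvd z_prim) mul2n.
by rewrite -!mul2n dvdn_pmul2l.
Qed.

End Pair.

(** For involutive reflections, the two sides of the braid relation of length
    n differ by the n-th power of the product. *)
Lemma iter_alternating u v n f :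
  iter n (reflection u false \o reflection v false)
    (word_act reflection (alternating n v u) f) =
  word_act reflection (alternating n u v) f.
Proof.
elim: n u v => [//|n IHn] u v; rewrite iterSr /= (reflectionK v false).
rewrite -(IHn v u); move: (word_act _ _ _) => g; elim: n {IHn} => [//|n IHn].
by rewrite iterS /= -IHn.
Qed.

Lemma reflection_acts : presents_action (@coxeter_rel Gamma) setT reflection.
Proof.
split=> // [x b f _|r1 r2]; first exact: reflectionK.
case=> [[u [v [Euv -> ->]]]|[v [-> ->]]] f _; last exact: (reflectionK v false).
by rewrite -iter_alternating iter_reflection //; exact: edge_neq.
Qed.

Definition reflection_act :
    coxeter_group Gamma -> (vertex Gamma -> F) -> vertex Gamma -> F :=
  presented_act (R := @coxeter_rel Gamma) reflection.

Lemma reflection_act1 f : reflection_act 1%g f = f.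
Proof. exact: (presented_act1 reflection_acts). Qed.

Lemma reflection_actM w1 w2 f :
  reflection_act (w1 * w2)%g f = reflection_act w1 (reflection_act w2 f).
Proof. exact: (presented_actM reflection_acts). Qed.

Lemma reflection_act_gen v f : reflection_act (coxeter_gen v) f = reflection v false f.
Proof. exact: (presented_act_gen reflection_acts). Qed.

Lemma coxeter_order_algebraic u v n : u != v -> (0 < n)%N ->
  ((coxeter_gen u * coxeter_gen v) ^+ n = 1)%g ->
  [set u; v]%SET \in edges Gamma /\ (label [set u; v]%SET %| n)%N.
Proof.
move=> uv n0 uvn.
have iter1 f : iter n (reflection u false \o reflection v false) f = f.
  rewrite -[RHS]reflection_act1 -uvn; elim: (n) f => [|k IHk] f.
    by rewrite reflection_act1.
  by rewrite expgS iterS IHk !reflection_actM !reflection_act_gen.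
have [Euv|nE] := boolP ([set u; v]%SET \in edges Gamma).
  by split=> //; exact: iter_reflection_order.
have := iter1 (with_pair u v (fun=> 0) 1 0).
rewrite iter_reflection_free // => /(congr1 (fun f => f v)).
rewrite /with_pair (eq_sym v) (negPf uv) eqxx => /eqP.
by rewrite pnatr_eq0 double_eq0 (gtn_eqF n0).
Qed.


End ReflectionRepresentation.

Section CoxeterOrder.
Variable Gamma : labeled_graph.
Implicit Types (u v x y : vertex Gamma).
Local Notation c := (@coxeter_gen Gamma).

(** The reflection representation over the algebraic numbers detects the
    order. *)
Lemma coxeter_order u v n : u != v -> (0 < n)%N -> (c u * c v) ^+ n = 1 ->
  [set u; v]%SET \in edges Gamma /\ (label [set u; v]%SET %| n)%N.
Proof.
have root m : exists z : algC, (0 < m)%N -> (m.*2).-primitive_root%R z.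
  case: m => [|m]; first by exists 0%R.
  by have [z zP] := C_prim_root_exists (isT : (0 < m.+1.*2)%N); exists z.
have [zeta zetaP] := choice root.
exact: (coxeter_order_algebraic zetaP).

Qed.

Lemma coxeter_gen_inj : injective c.
Proof.
move=> u v cuv; apply: contrapT => /eqP uv.
have [|Euv] := @coxeter_order u v 1 uv isT; first by rewrite cuv coxeter_genK.
by rewrite dvdn1 => /eqP l1; have := label_ge2 Euv; rewrite l1.
Qed.

(** Labels can be recovered from the orders of products of generators, and
    these are invariant under conjugation. *)
Lemma coxeter_conj_label w x y u v : x != y -> [set u; v]%SET \in edges Gamma ->
  w * c x * w^-1 = c u -> w * c y * w^-1 = c v ->
  [set x; y]%SET \in edges Gamma /\ label [set x; y]%SET = label [set u; v]%SET.
Proof.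
move=> xy Euv wx wy; have uv := edge_neq Euv.
have conjX n : w * (c x * c y) ^+ n * w^-1 = (c u * c v) ^+ n.
  elim: n => [|n IHn]; first by rewrite mulg1 mulgV.
  by rewrite !expgS -IHn -wx -wy !mulgA !mulgVK.
have braid a b : [set a; b]%SET \in edges Gamma ->
    (c a * c b) ^+ label [set a; b]%SET = 1.
  by move=> Eab; rewrite -alt_divE ?coxeter_genK // (coxeter_braid Eab) mulgV.
have [||Exy dvd1] := @coxeter_order x y (label [set u; v]%SET) xy.
- exact: ltnW (label_ge2 Euv).
- by apply: (mulgI w); apply: (mulIg w^-1); rewrite conjX braid // mulg1 mulgV.
split=> //; apply/eqP; rewrite eqn_dvd dvd1 /=.
have [||_ //] := @coxeter_order u v (label [set x; y]%SET) uv.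
- exact: ltnW (label_ge2 Exy).
- by rewrite -conjX braid // mulg1 mulgV.
Qed.

End CoxeterOrder.

(** * The retraction onto a standard parabolic subgroup *)

Section ArtinGenerators.
Variable Gamma : labeled_graph.
Implicit Types (u v : vertex Gamma) (X : {set vertex Gamma}).

Lemma artin_braid u v : [set u; v]%SET \in edges Gamma ->
  let m := label [set u; v]%SET in
  alt m (artin_gen u) (artin_gen v) = alt m (artin_gen v) (artin_gen u).
Proof.
move=> Euv m; rewrite -!alternating_class; apply/presented_classP/word_eq_rel.
by exists u, v.
Qed.

Lemma standard_parabolic_subgroup X : is_subgroup (standard_parabolic X).
Proof. exact: generated_subgroup. Qed.

Lemma standard_parabolic_gen X v : v \in X -> standard_parabolic X (artin_gen v).
Proof. by move=> vX; apply: sub_generated; exists v. Qed.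

End ArtinGenerators.

Section Retraction.
Variables (Gamma : labeled_graph) (X : {set vertex Gamma}).
Local Notation A := (artin_group Gamma).
Local Notation W := (coxeter_group Gamma).
Local Notation g_ := (@artin_gen Gamma).
Local Notation c := (@coxeter_gen Gamma).
Implicit Types (u v x y s : vertex Gamma) (w : W) (a b : A) (p : W * A).

(** The state (w, a) stands for the coset of W_X represented by w, with a
    recording the part in A_X that has been split off so far.  In the first
    case s w = w x, so the coset is fixed by s and the generator x is split
    off; in the second one s w is again reduced. *)
Definition retract_step s (e : bool) (p : W * A) : W * A :=
  if [pick x in X | p.1 * c x * p.1^-1 == c s] is Some x
  then (p.1, (if e then (g_ x)^-1 else g_ x) * p.2)
  else (c s * p.1, p.2).

(** These w are the shortest representatives of their cosets w W_X. *)
Definition coset_reduced : set (W * A) :=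
  [set p | forall x, x \in X -> flip p.1 (c x) = false].

Lemma conj_inj w x y : w * c x * w^-1 = w * c y * w^-1 -> x = y.
Proof. by move/mulIg/mulgI/coxeter_gen_inj. Qed.

Lemma retract_step_stay s e w a x : x \in X -> w * c x * w^-1 = c s ->
  retract_step s e (w, a) = (w, (if e then (g_ x)^-1 else g_ x) * a).
Proof.
move=> xX wx; rewrite /retract_step /=; case: pickP => [y /andP[_ /eqP wy]|/(_ x)].
  by have -> : y = x by apply: (@conj_inj w); rewrite wx wy.
by rewrite xX wx eqxx.
Qed.

Lemma retract_step_move s e w a : (forall x, x \in X -> w * c x * w^-1 <> c s) ->
  retract_step s e (w, a) = (c s * w, a).
Proof.
move=> nw; rewrite /retract_step /=; case: pickP => // y /andP[yX /eqP].
by move/(nw _ yX).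
Qed.

(** Only the root of s changes sign under s, and in the case of a move it is
    not the image under w of the root of an element of X. *)
Lemma retract_step_closed s e p : coset_reduced p -> coset_reduced (retract_step s e p).
Proof.
case: p => w a rp; rewrite /retract_step; case: pickP => [//|nx] x xX.
have := nx x; rewrite /= xX /= => nx'; rewrite flipM flip_gen nx' addbF.
exact: rp.
Qed.

Lemma retract_stepK s e p : retract_step s e (retract_step s (~~ e) p) = p.
Proof.
case: p => w a.
have [[x xX wx]|nw] := pselect (exists2 x, x \in X & w * c x * w^-1 = c s).
  rewrite !(retract_step_stay _ _ xX wx) mulgA.
  by case: e; rewrite /= ?mulgV ?mulVg mul1g.
have nw' x : x \in X -> w * c x * w^-1 <> c s by move=> xX wx; apply: nw; exists x.
rewrite (retract_step_move _ _ nw') retract_step_move.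
  by rewrite mulgA coxeter_genK mul1g.
move=> x xX; rewrite invgM coxeter_genV => E; apply: (nw' x xX).
have := congr1 (fun t => c s * t * c s) E.
by rewrite !mulgA coxeter_genK !mul1g -(mulgA _ (c s)) coxeter_genK mulg1.
Qed.

Local Notation run := (word_act retract_step).

Section Pair.
Variables (J : {set vertex Gamma}) (w : W) (a : A).

Lemma coxeter_sub_alt n u v :
  u \in J -> v \in J -> coxeter_sub J (alt n (c u) (c v)).
Proof.
have [W1 WM _] := coxeter_sub_subgroup J.
by elim: n u v => [//|n IHn] u v uJ vJ /=; apply: (WM);
  [exact: coxeter_sub_gen | exact: IHn].
Qed.

Lemma coxeter_sub_conj d t :
  coxeter_sub J d -> coxeter_sub J (d * t * d^-1) -> coxeter_sub J t.
Proof.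
have [W1 WM WV] := coxeter_sub_subgroup J; move=> Jd Jdt.
have := WM _ _ (WM _ _ (WV _ Jd) Jdt) Jd.
by rewrite !mulgA mulVg mul1g mulgVK.
Qed.

Lemma run_free n u v : u \in J -> v \in J ->
  (forall x, x \in X -> ~ coxeter_sub J (w * c x * w^-1)) ->
  run (alternating n u v) (w, a) = (alt n (c u) (c v) * w, a).
Proof.
move=> + + nJ; elim: n u v => [|n IHn] u v uJ vJ /=; first by rewrite mul1g.
rewrite IHn // retract_step_move ?mulgA // => x xX E; apply: (nJ x xX).
apply: (@coxeter_sub_conj (alt n (c v) (c u))); first exact: coxeter_sub_alt.
by have := coxeter_sub_gen uJ; rewrite -{1}E invgM !mulgA.
Qed.

(** Each hit of the reflection w x w^-1 keeps the coset and splits off one x;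
    all other letters move the coset.  Since x^2 = 1 in W, the factor c x ^+ k
    in the first component makes up for the letters that did not move it. *)
Lemma run_single n u v x :
  u \in J -> v \in J -> x \in X -> coxeter_sub J (w * c x * w^-1) ->
  (forall y, y \in X -> coxeter_sub J (w * c y * w^-1) -> y = x) ->
  let k := hits n (c u) (c v) (w * c x * w^-1) in
  run (alternating n u v) (w, a) = (alt n (c u) (c v) * w * c x ^+ k, g_ x ^+ k * a).
Proof.
move=> + + xX Jx uniqx /=; have [W1 WM WV] := coxeter_sub_subgroup J.
elim: n u v => [|n IHn] u v uJ vJ /=; first by rewrite mul1g mulg1 mul1g.
rewrite IHn //; set k := hits _ _ _ _; set d := alt n _ _.
have cxk : c x ^+ k * c x * (c x ^+ k)^-1 = c x.
  by rewrite -expgSr expgS mulgK.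
have Jd : coxeter_sub J d by exact: coxeter_sub_alt.
have cw : d * w * c x ^+ k * c x * (d * w * c x ^+ k)^-1 = d * (w * c x * w^-1) * d^-1.
  by rewrite !invgM -!mulgA (mulgA (c x ^+ k)) (mulgA _ (_ ^-1)) cxk.
have [E|nE] := eqVneq (d * (w * c x * w^-1) * d^-1) (c u).
  have E' := etrans cw E.
  rewrite (retract_step_stay _ _ xX E') addn1 !expgS mulgA; congr (_, _).
  rewrite -{1}E !mulgA -(mulgA _ d^-1) mulVg mulg1 -(mulgA _ w^-1) mulVg mulg1.
  by rewrite -(mulgA _ (c x) (c x)) coxeter_genK mulg1.
rewrite addn0 retract_step_move ?mulgA // => y yX Ey.
have yx : y = x.
  apply: uniqx => //; have Jt : coxeter_sub J (w * c x ^+ k * w^-1).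
    elim: (k) => [|i IHi]; first by rewrite mulg1 mulgV.
    by have := WM _ _ Jx IHi; rewrite expgS !mulgA mulgVK.
  apply: (coxeter_sub_conj Jt); apply: (coxeter_sub_conj Jd).
  have := coxeter_sub_gen uJ; rewrite -Ey.
  by rewrite !invgM !invgK !mulgA !mulgVK.
by move: nE; rewrite -Ey yx cw eqxx.
Qed.

Lemma run_fixed n u v x y : x \in X -> y \in X ->
  w * c x * w^-1 = c u -> w * c y * w^-1 = c v ->
  run (alternating n u v) (w, a) = (w, alt n (g_ x) (g_ y) * a).
Proof.
elim: n u v x y => [|n IHn] u v x y xX yX wx wy /=; first by rewrite mul1g.
by rewrite (IHn _ _ y x) // (retract_step_stay _ _ xX wx) mulgA.
Qed.

End Pair.

(** Write w = d w' with d in W_J and w' minimal.  Then w' conjugates x and y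
    to the two distinct elements of J, and d keeps both of their roots
    positive because w is reduced; hence d = 1. *)
Lemma reduced_pair u v w x y :
  (forall z, z \in X -> flip w (c z) = false) -> x \in X -> y \in X -> x != y ->
  let J := [set u; v]%SET in
  coxeter_sub J (w * c x * w^-1) -> coxeter_sub J (w * c y * w^-1) ->
  (w * c x * w^-1 = c u /\ w * c y * w^-1 = c v) \/
  (w * c y * w^-1 = c u /\ w * c x * w^-1 = c v).
Proof.
move=> rw xX yX xy J Jx Jy.
have [d [w' [Jd E w'min]]] := min_coset_rep J w.
have [s sJ xs] := reduced_conj_simple Jd E w'min Jx.
have [t tJ yt] := reduced_conj_simple Jd E w'min Jy.
have st : s != t.
  apply: contra_neq xy => st; apply: (@conj_inj w'); by rewrite xs yt st.
have pos z r : z \in X -> r \in J -> w' * c z * w'^-1 = c r -> flip d (c r) = false.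
  move=> zX rJ zr; have := rw z zX; rewrite E flipM zr.
  suff -> : flip w' (c z) = false by [].
  have := flip1 (c z); rewrite -(mulVg w') flipM zr w'min ?addbF //.
  exact: coxeter_sub_gen.
have Jst r : r \in J -> r = s \/ r = t.
  move: sJ tJ st; rewrite !inE => /orP[]/eqP-> /orP[]/eqP->; rewrite ?eqxx //.
    by move=> _ /orP[]/eqP->; [left|right].
  by move=> _ /orP[]/eqP->; [right|left].
have d1 : d = 1.
  apply: (parabolic_reduced_eq1 Jd) => r /Jst[]->; [exact: pos xs | exact: pos yt].
rewrite E d1 mul1g xs yt.
move: sJ tJ st; rewrite !inE => /orP[]/eqP-> /orP[]/eqP->; rewrite ?eqxx //.
  by left.
by right.
Qed.

(** How the coset meets the dihedral group of u and v depends on the number of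
    elements of X that w conjugates into it.  If there is none, all letters
    move the coset.  If there is one, both sides split off it equally often.
    If there are two, u and v fix the coset and split off two generators of
    the same label, whose braid relation gives the claim. *)
Lemma retract_step_rel r1 r2 : artin_rel r1 r2 ->
  forall p, coset_reduced p -> run r1 p = run r2 p.
Proof.
case=> u [v [Euv -> ->]] [w a] rw; set m := label _.
pose J := [set u; v]%SET.
have uJ : u \in J by rewrite !inE eqxx.
have vJ : v \in J by rewrite !inE eqxx orbT.
have B := coxeter_braid Euv.
have [[x [xX Jx]]|nJ] :=
  pselect (exists x, x \in X /\ coxeter_sub J (w * c x * w^-1)); last first.
  have nJ' x : x \in X -> ~ coxeter_sub J (w * c x * w^-1).
    by move=> xX Jx; apply: nJ; exists x.
  by rewrite !(run_free _ _ _ _ nJ') // B.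
have [[y [yX Jy xy]]|nu] :=
  pselect (exists y, [/\ y \in X, coxeter_sub J (w * c y * w^-1) & x != y]).
  wlog [wx wy] : x y xX yX xy Jx Jy / w * c x * w^-1 = c u /\ w * c y * w^-1 = c v.
    move=> H; have [|H2] := reduced_pair rw xX yX xy Jx Jy; first exact: H.
    by apply: (H y x) => //; rewrite eq_sym.
  have [Exy lxy] := coxeter_conj_label xy Euv wx wy.
  rewrite (run_fixed _ _ xX yX wx wy) (run_fixed _ _ yX xX wy wx) /m -lxy.
  by rewrite artin_braid.
have uniqx y : y \in X -> coxeter_sub J (w * c y * w^-1) -> y = x.
  move=> yX Jy; apply: contrapT => yx; apply: nu; exists y; split=> //.
  by apply/eqP => xy; apply: yx.
rewrite !(run_single _ _ _ _ xX Jx uniqx) // B.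
by rewrite (hits_sym _ _ _ B) ?coxeter_genK.
Qed.

Lemma retract_step_acts : presents_action (@artin_rel Gamma) coset_reduced retract_step.
Proof.
split; [exact: retract_step_closed | | exact: retract_step_rel].
by move=> x b p _; exact: retract_stepK.
Qed.

Definition retract_act : A -> W * A -> W * A :=
  presented_act (R := @artin_rel Gamma) retract_step.

Let act_gen v p : coset_reduced p -> retract_act (g_ v) p = retract_step v false p.
Proof. exact: (presented_act_gen retract_step_acts). Qed.

Let actM a b p : coset_reduced p -> retract_act (a * b) p = retract_act a (retract_act b p).
Proof. exact: (presented_actM retract_step_acts). Qed.

Let act1 p : coset_reduced p -> retract_act 1 p = p.
Proof. exact: (presented_act1 retract_step_acts). Qed.

Let act_closed a p : coset_reduced p -> coset_reduced (retract_act a p).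
Proof. exact: (presented_act_closed retract_step_acts). Qed.

Let reduced1 a : coset_reduced (1, a).
Proof. by move=> x _; rewrite flip1. Qed.

Let AX := @standard_parabolic Gamma X.

Lemma retract_actMr a w b b' :
  retract_act a (w, b * b') = ((retract_act a (w, b)).1, (retract_act a (w, b)).2 * b').
Proof.
rewrite /retract_act /presented_act; elim: (repr a) => [//|[s e] r IHr] /=.
rewrite IHr /retract_step /=; case: pickP => [x _|_] //=.
by rewrite mulgA.
Qed.

Lemma retract_act_snd a p : AX p.2 -> AX (retract_act a p).2.
Proof.
have [_ KM KV] := standard_parabolic_subgroup X.
move=> Xp; rewrite /retract_act /presented_act.
elim: (repr a) => [//|[s e] r IHr] /=.
rewrite /retract_step; case: pickP => [x /andP[xX _]|_] //=; apply: (KM) => //.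
by case: e; [apply: KV|]; exact: standard_parabolic_gen.
Qed.

Lemma retract_act_parabolic a b : AX a -> retract_act a (1, b) = (1, a * b).
Proof.
suff H : AX `<=` [set a | forall b, retract_act a (1, b) = (1, a * b)] by move/H; exact.
apply: generated_min; first split=> [b'|a1 a2 H1 H2 b'|a1 H1 b'].
- by rewrite act1 ?mul1g.
- by rewrite actM // H2 H1 mulgA.
- rewrite -{1}(mulVKg a1 b').
  by rewrite -H1 -actM // mulVg act1.
move=> _ [x xX <-] b' /=; rewrite act_gen // (retract_step_stay _ _ xX) //.
by rewrite mul1g invg1 mulg1.
Qed.

(** A generator outside X moves the coset of the identity, which all elements
    of A_X fix. *)
Lemma standard_parabolic_notin v : v \notin X -> ~ AX (g_ v).
Proof.
move=> vX /(@retract_act_parabolic _ 1); rewrite act_gen // retract_step_move.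
  by case=> /eqP; rewrite mulg1 (negPf (coxeter_gen_neq1 v)).
move=> x xX; rewrite mul1g invg1 mulg1 => /coxeter_gen_inj xv.
by move: vX; rewrite -xv xX.
Qed.

(** Let a^-1 send (1, 1) to (w, h), and let b = a s a^-1 with s in Y.  From
    s a^-1 = a^-1 b it follows that s sends (w, h) to (w, h b).  So s fixes the
    coset of w and splits off some x in X, with x h = h b, which means that
    b = h^-1 x h. *)
Lemma parabolic_sub_standard (Y : {set vertex Gamma}) a :
  conjs a (standard_parabolic Y) `<=` AX ->
  exists h (Z : {set vertex Gamma}), [/\ AX h, Z \subset X &
    conjs a (standard_parabolic Y) = conjs h (standard_parabolic Z)].
Proof.
move=> aY.
case E : (retract_act a^-1 (1, 1)) => [w h].
have Xh : AX h.
  have := @retract_act_snd a^-1 (1, 1); rewrite E; apply.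
  by have [] := standard_parabolic_subgroup X.
have rw : coset_reduced (w, h) by rewrite -E; exact: act_closed.
have stay s : s \in Y -> exists2 x, x \in X & a * g_ s * a^-1 = h^-1 * g_ x * h.
  move=> sY; set b := a * g_ s * a^-1.
  have Xb : AX b by apply: aY; exists (g_ s) => //; exact: standard_parabolic_gen.
  have : retract_act (g_ s) (w, h) = (w, h * b).
    have ab : g_ s * a^-1 = a^-1 * b by rewrite /b !mulgA mulVg mul1g.
    rewrite -{1}E -actM // ab actM // retract_act_parabolic // mulg1.
    by rewrite -{1}(mul1g b) retract_actMr E.
  rewrite act_gen //.
  have [[x xX wx]|nw] := pselect (exists2 x, x \in X & w * c x * w^-1 = c s).
    rewrite (retract_step_stay _ _ xX wx) => -[Eb]; exists x => //.
    by rewrite -mulgA Eb mulKg.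
  (* If s moved the coset, s w = w would make s trivial in W. *)
  rewrite retract_step_move; last by move=> x xX wx; apply: nw; exists x.
  case=> /eqP; rewrite -{2}[w]mul1g (inj_eq (mulIg w)).
  by rewrite (negPf (coxeter_gen_neq1 s)).
pose Z := [set x in X | `[< exists2 s, s \in Y & a * g_ s * a^-1 = h^-1 * g_ x * h >]]%SET.
exists h^-1, Z; split.
- by have [_ _ KV] := standard_parabolic_subgroup X; exact: KV.
- by apply/fintype.subsetP => x; rewrite inE => /andP[].
rewrite !conjs_generated; congr generated; apply/seteqP; split=> _ [_ [s sY <-] <-].
  have [x xX Ex] := stay s sY; exists (g_ x); last by rewrite Ex invgK.
  exists x => //=; rewrite inE xX; apply/asboolP; by exists s.
move: sY; rewrite /= inE => /andP[_ /asboolP[x xY Ex]].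
by exists (g_ x); [exists x | rewrite Ex invgK].
Qed.

End Retraction.

(** * Parabolic closures *)

Section ParabolicClosure.
Variable Gamma : labeled_graph.
Local Notation A := (artin_group Gamma).
Implicit Types (X Y Z : {set vertex Gamma}) (a b : A) (S H Q : set A).

(** Hence the size of X can serve as the rank of a parabolic subgroup: it goes
    down in proper inclusions. *)
Lemma parabolic_sub_card X Y a b :
  conjs a (standard_parabolic Y) `<=` conjs b (standard_parabolic X) ->
  conjs a (standard_parabolic Y) = conjs b (standard_parabolic X) \/
  exists k Z, #|Z| < #|X| /\
    conjs a (standard_parabolic Y) = conjs k (standard_parabolic Z).
Proof.
move=> aYbX; have [|h [Z [Xh ZX E]]] := @parabolic_sub_standard _ X Y (b^-1 * a).
  by rewrite -conjsM; apply: (conjs_sub _ _ _).2; rewrite invgK.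
have aYE : conjs a (standard_parabolic Y) = conjs (b * h) (standard_parabolic Z).
  by rewrite -conjsM -E conjsM mulVKg.
have [ZXE|ZnX] := eqVneq Z X.
  left; rewrite aYE ZXE -conjsM (conjs_mem _ Xh) //; exact: standard_parabolic_subgroup.
right; exists (b * h), Z; split=> //; apply: proper_card.
by rewrite finset.properEneq ZnX.
Qed.

Hypothesis classA : parabolic_intersection Gamma.

(** A parabolic of minimal rank among those containing S lies in every other
    one, since its intersection with Q is a parabolic of at least the same
    rank. *)
Lemma parabolic_closure S : exists a X,
  [/\ S `<=` conjs a (standard_parabolic X),
      forall b Z, S `<=` conjs b (standard_parabolic Z) -> #|X| <= #|Z| &
      forall Q, parabolic Q -> S `<=` Q -> conjs a (standard_parabolic X) `<=` Q].
Proof.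
pose P n := `[< exists a X, #|X| = n /\ S `<=` conjs a (standard_parabolic X) >].
have [|n /asboolP[a [X [<- SX]]] minX] := @ex_minnP P.
  exists #|[set: vertex Gamma]%SET|; apply/asboolP; exists 1, [set: vertex Gamma]%SET.
  split=> // x _; rewrite conjs1.
  apply: (@presented_ind _ (@artin_rel Gamma)) => [|v].
    exact: standard_parabolic_subgroup.
  by apply: standard_parabolic_gen; rewrite inE.
have minX' b Z : S `<=` conjs b (standard_parabolic Z) -> #|X| <= #|Z|.
  by move=> SZ; apply: minX; apply/asboolP; exists b, Z.
exists a, X; split=> // Q pQ SQ.
have [b [Z E]] : parabolic (conjs a (standard_parabolic X) `&` Q).
  by apply: classA => //; exists a, X.
have [x Xx|EX|[k [Y [YX EY]]]] := @parabolic_sub_card X Z b a.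
- by have [] : (conjs a (standard_parabolic X) `&` Q) x by rewrite E.
- by rewrite -EX -[conjs b _]E; apply: subIsetr.
- have : #|X| <= #|Y|.
    apply: (minX' k); rewrite -EY -[conjs b _]E => x Sx.
    by split; [exact: SX | exact: SQ].
  by rewrite leqNgt YX.
Qed.

(** Take a finite part F of H whose closure has the largest rank.  Adding a
    further element of H to F cannot enlarge the closure, as this would raise
    its rank. *)
Lemma finite_parabolic_closure H : exists F : seq A,
  (forall x, x \in F -> H x) /\
  forall Q, parabolic Q -> (forall x, x \in F -> Q x) -> H `<=` Q.
Proof.
pose P n := `[< exists F : seq A, (forall x, x \in F -> H x) /\
  exists a X, [/\ #|X| = n, [set` F] `<=` conjs a (standard_parabolic X) &
  forall b Z, [set` F] `<=` conjs b (standard_parabolic Z) -> #|X| <= #|Z|] >].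
have exP : exists n, P n.
  have [a [X [FX minX _]]] := parabolic_closure [set` [::] : seq A].
  by exists #|X|; apply/asboolP; exists [::]; split=> //; exists a, X.
have bP n : P n -> n <= #|vertex Gamma|.
  by move=> /asboolP[F [_ [a [X [<- _ _]]]]]; exact: max_card.
case: (ex_maxnP exP bP) => n /asboolP[F [HF [a [X [nX FX minX]]]]] maxn.
exists F; split=> // Q pQ FQ x Hx.
have [b [Y [FY minY clY]]] := parabolic_closure [set` x :: F].
have YX : #|Y| <= #|X|.
  rewrite nX; apply: maxn; apply/asboolP; exists (x :: F); split.
    by move=> y; rewrite inE => /predU1P[->|/HF].
  by exists b, Y.
have [a' [X' [FX' minX' clX']]] := parabolic_closure [set` F].
have X'X : #|X| <= #|X'| := minX _ _ FX'.
have FY' : [set` F] `<=` conjs b (standard_parabolic Y).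
  by move=> y Fy; apply: FY; rewrite /= inE; apply/orP; right.
have X'Y : conjs a' (standard_parabolic X') `<=` conjs b (standard_parabolic Y).
  by apply: clX' => //; exists b, Y.
have [E|[k [Z [ZY E]]]] := parabolic_sub_card X'Y.
  by apply: (clX' _ pQ FQ); rewrite E; apply: FY; rewrite /= inE eqxx.
have : #|X| <= #|Z| by apply: (minX k); rewrite -E.
by rewrite leqNgt (leq_trans ZY YX).
Qed.

End ParabolicClosure.

(** * Trees, levels and elliptic elements *)

Section Trees.
Variables (T : eqType) (adj : rel T) (side : T -> bool).

Fixpoint walk n x y : Prop :=
  if n is n'.+1 then exists2 z, adj x z & walk n' z y else x = y.

Lemma walk_cat m n x y z : walk m x y -> walk n y z -> walk (m + n) x z.
Proof.
move=> + yz; elim: m x => [x -> //|m IHm x [x' xx' x'y]].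
by exists x' => //; exact: IHm.
Qed.

(** A function chi that does not change along edges away from x tells apart
    the branches at x: a cut singles out the branch of y.  The existence of
    cuts is a local form of the absence of cycles. *)
Definition cut (chi : T -> bool) x y : Prop :=
  (forall p q, adj p q -> p != x -> q != x -> chi p = chi q) /\
  (forall y', adj x y' -> y' != y -> chi y' != chi y).

Lemma walk_simplicial (G : groupType) (act : G -> T -> T) g n x y :
  simplicial_action adj act -> walk n x y -> walk n (act g x) (act g y).
Proof.
case=> _ _ act_adj; elim: n x => [x -> //|n IHn x [z xz /IHn zy]].
by exists (act g z) => //; rewrite act_adj.
Qed.

Hypothesis adj_sym : symmetric adj.
Hypothesis adj_side : forall x y, adj x y -> side y = ~~ side x.

Lemma walk_sym n x y : walk n x y -> walk n y x.
Proof.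
elim: n x => [x -> //|n IHn x [z xz /IHn yz]].
by rewrite -addn1; apply: walk_cat yz _; exists x; rewrite // adj_sym.
Qed.

Hypothesis connected : forall x y, exists n, walk n x y.
Hypothesis cuts : forall x y, adj x y -> exists chi, cut chi x y.

Fact level_ex z x : exists n, `[< walk n x z >].
Proof. by have [n xz] := connected x z; exists n; apply/asboolP. Qed.

(** The level of x is its distance to z. *)
Definition level z x : nat := ex_minn (level_ex z x).

Lemma level_walk z x : walk (level z x) x z.
Proof. by rewrite /level; case: ex_minnP => n /asboolP. Qed.

Lemma level_min z x n : walk n x z -> level z x <= n.
Proof. by rewrite /level; case: ex_minnP => k _ min_k xz; apply/min_k/asboolP. Qed.

Lemma walk_side n x y : walk n x y -> side y = side x (+) odd n.
Proof.
elim: n x => [x ->|n IHn x [z /adj_side zx /IHn ->]]; first by rewrite addbF.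
by rewrite zx /= addbN addNb.
Qed.

Lemma level_neq z x y : adj x y -> level z x != level z y.
Proof.
move=> xy; apply/eqP => E; have := walk_side (level_walk z x).
by rewrite E (walk_side (level_walk z y)) (adj_side xy); case: side; case: odd.
Qed.

Lemma level_lower z x : x != z ->
  exists2 y, adj x y & level z y < level z x.
Proof.
have := level_walk z x; case: (level z x) => [/= ->|n [y xy yz] _]; first by rewrite eqxx.
by exists y => //; rewrite ltnS; exact: level_min.
Qed.

(** From a vertex below x one descends to z without touching x, so chi takes
    the same value at all lower neighbours of x. *)
Lemma lower_unique z x y y' : adj x y -> adj x y' ->
  level z y < level z x -> level z y' < level z x -> y' = y.
Proof.
move=> xy xy' yz y'z; have [chi [chiE chiN]] := cuts xy.
have chi_z p : level z p < level z x -> chi p = chi z.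
  have [n] := ubnP (level z p); elim: n p => // n IHn p; rewrite ltnS => pn px.
  have [-> //|pz] := eqVneq p z.
  have [q pq qp] := level_lower pz; rewrite (chiE p q) //.
  - by apply: IHn; [exact: leq_trans qp pn | exact: ltn_trans qp px].
  - by apply: contraTneq px => ->; rewrite ltnn.
  - by apply: contraTneq px => <-; rewrite -leqNgt ltnW.
by apply: contrapT => /eqP/(chiN _ xy'); rewrite !chi_z ?eqxx.
Qed.

Lemma walk_fun n x y : walk n x y ->
  exists xs : nat -> T, [/\ xs 0 = x, xs n = y & forall i, i < n -> adj (xs i) (xs i.+1)].
Proof.
elim: n x => [x ->|n IHn x [z xz /IHn[xs [x0 xn xadj]]]]; first by exists (fun=> y).
exists (fun i => if i is j.+1 then xs j else x); split=> // -[_|i] /=; first by rewrite x0.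
exact: xadj.
Qed.

(** In a cycle x, y, ... the arc from y to the other neighbour of x avoids x,
    so the cut of y at x does not distinguish these two neighbours. *)
Lemma cycle_bound : forall c, cycle adj c -> uniq c -> size c <= 2.
Proof.
case=> [|x [|y [|z s]]] //=; rewrite rcons_path /=.
move=> /and3P[xy yz /andP[zs lx]] /andP[xn /andP[yn _]].
have [chi [chiE chiN]] := cuts xy.
have := chiN (last z s); rewrite adj_sym lx => /(_ isT).
case: eqP => [lE|_ /(_ isT)]; first by move: yn; rewrite -lE mem_last.
suff -> : chi (last z s) = chi y by rewrite eqxx.
have : path adj y (z :: s) by rewrite /= yz.
rewrite -[last z s]/(last y (z :: s)).
move: (z :: s) xn => r; elim: r y {xy yz yn chiN} => //= t r IHr y.
rewrite !inE !negb_or => /and3P[xy xt xr] /andP[yt tr].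
by rewrite (IHr t) ?inE ?negb_or ?xt // (chiE y t) // eq_sym.
Qed.

Lemma cut_tree : inhabited T -> is_tree adj.
Proof.
move=> T0; split=> //; last exact: cycle_bound.
  by move=> x; apply/negP => /adj_side; case: side.
move=> x y; have [n] := connected x y.
elim: n x => [x ->|n IHn x [z xz /IHn[p zp <-]]]; first by exists [::].
by exists (z :: p) => //=; rewrite xz.
Qed.

Section Action.
Variables (G : groupType) (act : G -> T -> T).
Hypothesis act_simp : simplicial_action adj act.

Let act1 x : act 1 x = x. Proof. by have [] := act_simp. Qed.
Let actM g h x : act (g * h) x = act g (act h x). Proof. by have [] := act_simp. Qed.
Let act_adj g x y : adj (act g x) (act g y) = adj x y. Proof. by have [] := act_simp. Qed.
Let actK g x : act g^-1 (act g x) = x. Proof. by rewrite -actM mulVg. Qed.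
Let walk_act g n x y : walk n x y -> walk n (act g x) (act g y).
Proof. exact: walk_simplicial. Qed.

Let level_act g z x : level (act g z) (act g x) = level z x.
Proof.
apply/eqP; rewrite eqn_leq; apply/andP; split.
  by apply/level_min/walk_act/level_walk.
by apply: level_min; have := walk_act g^-1 (level_walk (act g z) (act g x)); rewrite !actK.
Qed.

(** Suppose that f h fixes z, put y = h z, and compare the distances to z and
    to y along the path.  Neither distance has a local maximum inside a
    reduced path.  They agree at both ends, because f fixes the first vertex
    and h the last one.  As f moves the second vertex, at least one of the two
    distances grows at the start, hence all along the path; as h moves the
    last vertex but one, they cannot both grow at the end, so the other one
    decreases all along the path.  This contradicts the agreement at the
    ends. *)
Lemma elliptic_product_hyperbolic f h n (xs : nat -> T) : 0 < n ->
  (forall i, i < n -> adj (xs i) (xs i.+1)) ->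
  (forall i, i.+1 < n -> xs i != xs i.+2) ->
  act f (xs 0) = xs 0 -> act f (xs 1%N) != xs 1%N ->
  act h (xs n) = xs n -> act h (xs n.-1) != xs n.-1 ->
  forall z, act (f * h) z <> z.
Proof.
move=> n0 xadj xred f0 f1 hn hn1 z; rewrite actM.
set y := act h z => fy.
have up w i j : i <= j -> j < n -> level w (xs i) < level w (xs i.+1) ->
    level w (xs j) < level w (xs j.+1).
  move=> + + wi; elim: j => [|j IHj]; first by rewrite leqn0 => /eqP <-.
  rewrite leq_eqVlt => /orP[/eqP <- //|]; rewrite ltnS => ij jn.
  have jj := IHj ij (ltnW jn); rewrite ltn_neqAle level_neq ?xadj //= leqNgt.
  apply/negP => jj2; have := xred j jn.
  rewrite (@lower_unique w (xs j.+1) (xs j.+2) (xs j)) ?eqxx //; first exact: xadj.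
  by rewrite adj_sym xadj // ltnW.
have E0 : level y (xs 0) = level z (xs 0) by rewrite -(level_act f) fy f0.
have En : level z (xs n) = level y (xs n) by rewrite -(level_act h) hn.
have n1 : n.-1 < n by rewrite prednK.
have start : level z (xs 0) < level z (xs 1%N) \/ level y (xs 0) < level y (xs 1%N).
  have [l0|zl0] := ltnP (level z (xs 0)) (level z (xs 1%N)); [by left|right].
  have zl : level z (xs 1%N) < level z (xs 0).
    by rewrite ltn_neqAle zl0 andbT eq_sym level_neq ?xadj.
  rewrite ltn_neqAle level_neq ?xadj //= leqNgt; apply: contra f1 => yl.
  apply/eqP; apply: (@lower_unique z (xs 0)) => //; first exact: xadj.
    by rewrite -{1}f0 act_adj xadj.
  by rewrite -{1}fy level_act -E0.
have finish : ~ (level z (xs n.-1) < level z (xs n) /\ level y (xs n.-1) < level y (xs n)).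
  have nn : adj (xs n) (xs n.-1) by rewrite adj_sym -{2}(prednK n0) xadj.
  case=> zl yl; move: hn1; rewrite (@lower_unique y (xs n) (xs n.-1) (act h (xs n.-1))) ?eqxx //.
    by rewrite -{1}hn act_adj.
  by rewrite level_act -En.
have mono w : level w (xs 0) < level w (xs 1%N) ->
    level w (xs n.-1) < level w (xs n) /\ level w (xs 0) < level w (xs n).
  move=> w0; split; first by have := up w 0 n.-1 (leq0n _) n1 w0; rewrite prednK.
  have: forall j, j < n -> level w (xs 0) < level w (xs j.+1).
    elim=> [//|j IHj] jn; apply: ltn_trans (IHj (ltnW jn)) _.
    exact: up w0.
  by move/(_ _ n1); rewrite prednK.
have anti w : ~ (level w (xs n.-1) < level w (xs n)) -> level w (xs n) < level w (xs 0).
  move=> wn; have: forall j, j < n -> level w (xs j.+1) < level w (xs 0).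
    elim=> [|j IHj] jn.
      rewrite ltn_neqAle eq_sym level_neq ?xadj //= leqNgt; apply/negP => w0.
      by apply: wn; have [] := mono w w0.
    apply: leq_ltn_trans (IHj (ltnW jn)); rewrite leqNgt; apply/negP => wj.
    by apply: wn; have := up w j.+1 n.-1 _ n1 wj; rewrite -ltnS prednK // => /(_ jn).
  by move/(_ _ n1); rewrite prednK.
case: start => /mono[ln l0].
  have /anti : ~ level y (xs n.-1) < level y (xs n) by move=> yl; apply: finish.
  by rewrite E0 -En ltnNge (ltnW l0).
have /anti : ~ level z (xs n.-1) < level z (xs n) by move=> zl; apply: finish.
by rewrite -E0 En ltnNge (ltnW l0).
Qed.

(** Induction on F: a shortest path from the fixed vertices of F to those of h
    is reduced, its second vertex is moved by some f in F, and its last vertex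
    but one is moved by h.  If its length were positive, f h would be
    hyperbolic. *)
Lemma finite_elliptic_fixpoint (x0 : T) (F : seq G) :
  locally_elliptic act ->
  exists x, forall f, f \in F -> act f x = x.
Proof.
move=> ell; elim: F => [|h F [p Fp]]; first by exists x0.
have [q hq] := ell h.
pose P n := `[< exists xs : nat -> T, [/\ forall f, f \in F -> act f (xs 0) = xs 0,
  act h (xs n) = xs n & forall i, i < n -> adj (xs i) (xs i.+1)] >].
have exP : exists n, P n.
  have [n /walk_fun[xs [xs0 xsn xadj]]] := connected p q.
  by exists n; apply/asboolP; exists xs; rewrite xs0 xsn.
case: (ex_minnP exP) => -[|n] /asboolP[xs [Fx hx xadj]] min_n.
  by exists (xs 0) => f; rewrite inE => /predU1P[->|/Fx].
have [f fF f1] : exists2 f, f \in F & act f (xs 1%N) != xs 1%N.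
  apply: contrapT => nof; suff /min_n : P n by rewrite ltnn.
  apply/asboolP; exists (fun i => xs i.+1); split=> // [f fF|i ilt]; last exact: xadj.
  by apply: contrapT => /eqP f1; apply: nof; exists f.
have h1 : act h (xs n) != xs n.
  apply/eqP => hn; suff /min_n : P n by rewrite ltnn.
  by apply/asboolP; exists xs; split=> // i /ltnW; exact: xadj.
have red i : i.+1 < n.+1 -> xs i != xs i.+2.
  move=> ilt; apply/eqP => E; suff /min_n : P n.-1.
    by rewrite leqNgt ltnS leq_pred.
  case: n ilt {exP h1} hx xadj min_n => [//|n] ilt hx xadj min_n /=.
  (* A backtracking step is removed from the path. *)
  apply/asboolP; exists (fun j => if j <= i then xs j else xs j.+2); split=> //.
    case: leqP => [ni|//]; have ein : i = n; last by rewrite -ein E ein.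
    by apply/eqP; rewrite eqn_leq ni andbT -2!ltnS.
  move=> j jn; case: (ltngtP j i) => [ji|ij|ji].
  - by apply: xadj; apply: leq_trans jn _; rewrite ltnW.
  - by apply: xadj; rewrite !ltnS.
  - by rewrite ji E; apply: xadj; rewrite !ltnS -ji.
have [z fz] := ell (f * h).
by case: (@elliptic_product_hyperbolic f h n.+1 xs isT xadj red (Fx f fF) f1 hx h1 z).
Qed.

End Action.
End Trees.

(** * The coset graph of two subgroups *)

Section CosetTree.
Variables (G : groupType) (A B : set G).
Hypotheses (subA : is_subgroup A) (subB : is_subgroup B).

Definition side_group (s : bool) : set G := if s then B else A.

Definition coset (s : bool) (g : G) : set G := [set h | side_group s (g^-1 * h)].

(** The boolean keeps cosets of A and of B apart, even when A = B. *)
Definition coset_vertex : Type :=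
  {p : bool * set G | `[< exists g, p.2 = coset p.1 g >]}.

HB.instance Definition _ := Equality.on coset_vertex.

Implicit Types (p q : coset_vertex) (s : bool) (g h k : G).

Definition coset_side p : bool := (val p).1.
Definition coset_set p : set G := (val p).2.

Definition coset_adj p q : bool :=
  (coset_side p != coset_side q) && `[< exists h, coset_set p h /\ coset_set q h >].

Lemma coset_of_subproof s g : `[< exists k, (s, coset s g).2 = coset (s, coset s g).1 k >].
Proof. by apply/asboolP; exists g. Qed.

Definition coset_of s g : coset_vertex := exist _ (s, coset s g) (coset_of_subproof s g).

Lemma side_subgroup s : is_subgroup (side_group s).
Proof. by case: s. Qed.

Lemma coset_id s g : coset s g g.
Proof. by have [S1 _ _] := side_subgroup s; rewrite /coset /= mulVg. Qed.

Lemma coset_eq s g h : coset s g h -> coset s g = coset s h.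
Proof.
have [S1 SM SV] := side_subgroup s; rewrite /coset /= => gh.
apply/seteqP; split=> k /= gk.
  by have := SM _ _ (SV _ gh) gk; rewrite invgM invgK -mulgA mulVKg.
by have := SM _ _ gh gk; rewrite -mulgA mulVKg.
Qed.

Lemma coset_ofE p h : coset_set p h -> p = coset_of (coset_side p) h.
Proof.
case: p => -[s S] pP; have /asboolP[g /= E] := pP.
by rewrite /coset_set /coset_side /= => Sh; apply: val_inj; rewrite /= E; rewrite E in Sh;
   rewrite (coset_eq Sh).
Qed.

Lemma coset_vertexP p : exists g, p = coset_of (coset_side p) g.
Proof.
case: p => -[s S] pP; have /asboolP[g /= E] := pP.
by exists g; apply: val_inj; congr (_, _); exact: E.
Qed.

Lemma coset_adj_sym : symmetric coset_adj.
Proof.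
move=> p q; rewrite /coset_adj eq_sym; congr (_ && _).
by apply/asboolP/asboolP => -[h [? ?]]; exists h.
Qed.

Lemma coset_adj_side p q : coset_adj p q -> coset_side q = ~~ coset_side p.
Proof. by move=> /andP[+ _]; case: coset_side; case: coset_side. Qed.

Lemma coset_adj_of g : coset_adj (coset_of false g) (coset_of true g).
Proof. by apply/andP; split=> //; apply/asboolP; exists g; split; exact: coset_id. Qed.

Lemma coset_adjP p q : coset_adj p q ->
  exists g, p = coset_of (coset_side p) g /\ q = coset_of (~~ coset_side p) g.
Proof.
move=> pq; rewrite -(coset_adj_side pq).
by case/andP: pq => _ /asboolP[h [/coset_ofE ph /coset_ofE qh]]; exists h.
Qed.

Lemma coset_mul s g k : [set h | coset s k (g^-1 * h)] = coset s (g * k).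
Proof. by apply/funext => h; rewrite /coset /= invgM mulgA. Qed.

Fact coset_act_subproof g p :
  `[< exists k, [set h | coset_set p (g^-1 * h)] = coset (coset_side p) k >].
Proof.
apply/asboolP; have [k ->] := coset_vertexP p; exists (g * k); exact: coset_mul.
Qed.

Definition coset_act g p : coset_vertex :=
  exist _ (coset_side p, [set h | coset_set p (g^-1 * h)]) (coset_act_subproof g p).

Lemma coset_act_of g s k : coset_act g (coset_of s k) = coset_of s (g * k).
Proof. by apply: val_inj; congr (_, _); exact: coset_mul. Qed.

Lemma coset_act_simplicial : simplicial_action coset_adj coset_act.
Proof.
split=> [p|g h p|g p q].
- by have [k ->] := coset_vertexP p; rewrite coset_act_of mul1g.
- by have [k ->] := coset_vertexP p; rewrite !coset_act_of mulgA.
rewrite /coset_adj; congr (_ && _); apply/asboolP/asboolP => -[h [ph qh]].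
  by exists (g^-1 * h).
by exists (g * h); rewrite /coset_set /= mulKg.
Qed.

Lemma coset_act_fix g s k :
  coset_act g (coset_of s k) = coset_of s k <-> conjs k (side_group s) g.
Proof.
rewrite coset_act_of; split=> [/(congr1 coset_set)|/conjsP kgk].
  rewrite /coset_set /= => E; apply/conjsP.
  by have := coset_id s (g * k); rewrite E /coset /= mulgA.
by apply: val_inj; rewrite /= -(@coset_eq s k (g * k)) // /coset /= mulgA.
Qed.

Lemma coset_act_inversion : without_inversion coset_adj coset_act.
Proof.
move=> g p q /coset_adj_side pq [E _]; move: pq.
by rewrite -E -[coset_side (coset_act g p)]/(coset_side p); case: coset_side.
Qed.

Hypothesis generate : forall K, is_subgroup K -> A `<=` K -> B `<=` K -> forall g, K g.

Local Notation walk := (walk coset_adj).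

(** The elements g for which the vertex g A can be joined to A form a subgroup;
    it contains A trivially, and it contains B through the vertex B. *)
Lemma coset_connected p q : exists n, walk n p q.
Proof.
pose o := coset_of false 1.
have og g : exists n, walk n o (coset_of false g).
  apply: (generate (K := [set g | exists n, walk n o (coset_of false g)])).
  - split=> [|x y [m ox] [n oy]|x [n ox]]; first by exists 0%N.
      exists (m + n)%N; apply: walk_cat ox _; rewrite -(mulg1 x).
      have := @walk_simplicial _ _ _ _ x _ _ _ coset_act_simplicial oy.
      by rewrite !coset_act_of mulg1.
    exists n; apply: (walk_sym coset_adj_sym).
    have := @walk_simplicial _ _ _ _ x^-1 _ _ _ coset_act_simplicial ox.
    by rewrite !coset_act_of mulg1 mulVg.
  - move=> a Aa; exists 0%N => /=; apply: coset_ofE.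
    by rewrite /coset_set /coset /= invg1 mul1g.
  - move=> b Bb; exists 2; exists (coset_of true 1); first exact: coset_adj_of.
    exists (coset_of false b) => //=.
    have -> : coset_of true 1 = coset_of true b.
      by apply: coset_ofE; rewrite /coset_set /coset /= invg1 mul1g.
    by rewrite coset_adj_sym coset_adj_of.
have op r : exists n, walk n o r.
  have [g ->] := coset_vertexP r; have [n on] := og g.
  case: (coset_side r); last by exists n.
  exists (n + 1)%N; apply: walk_cat on _; exists (coset_of true g) => //.
  exact: coset_adj_of.
have [m /(walk_sym coset_adj_sym) po] := op p; have [n oq] := op q.
by exists (m + n)%N; exact: walk_cat po oq.
Qed.

(** The value D s g is a set of group elements, regarded as a mod 2 chain of
    edges; it depends only on the coset of g, and it changes by the edge of g
    when passing from one end of this edge to the other. *)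
Variables (D : bool -> G -> G -> bool).
Hypothesis D_coset : forall s g k, side_group s k -> D s (g * k) = D s g.
Hypothesis D_edge : forall g h,
  D false g h (+) D true g h = `[< A (g^-1 * h) /\ B (g^-1 * h) >].

Definition potential p : G -> bool :=
  D (coset_side p) (xget 1 (coset_set p)).

Lemma potentialE s g : potential (coset_of s g) = D s g.
Proof.
rewrite /potential /coset_side /=; case: xgetP => [k _ /= gk|/(_ g)]; last first.
  by case; exact: coset_id.
by rewrite -(mulVKg g k) D_coset.
Qed.

Lemma potential_adj p q h : coset_adj p q ->
  potential p h (+) potential q h = `[< coset_set p h /\ coset_set q h >].
Proof.
case/coset_adjP => g [-> ->]; rewrite !potentialE.
case: (coset_side p); rewrite /= ?D_edge //.
by rewrite addbC D_edge; apply: asbool_equiv_eq; split=> -[].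
Qed.

(** Choose h in the edge from p to q.  Membership of h in the potential changes
    exactly across this edge, so it singles out q among the neighbours of p,
    and it is constant along all edges that do not touch p. *)
Lemma coset_cuts p q : coset_adj p q -> exists chi, cut coset_adj chi p q.
Proof.
move=> pq; have /andP[_ /asboolP[h [ph qh]]] := pq.
exists (potential^~ h); split=> [r s rs rp sp|r pr rq].
  have := potential_adj h rs; case: asboolP => [[rh sh] _|_].
    have [E|E] := eqVneq (coset_side r) (coset_side p).
      by move: rp; rewrite (coset_ofE rh) E -(coset_ofE ph) eqxx.
    move: sp; rewrite (coset_ofE sh) (coset_adj_side rs).
    suff -> : ~~ coset_side r = coset_side p by rewrite -(coset_ofE ph) eqxx.
    by move: E; case: coset_side; case: coset_side.
  by case: potential; case: potential.
have := potential_adj h pq; rewrite (asboolT (conj ph qh)).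
have := potential_adj h pr; case: asboolP => [[_ rh]|_].
  move: rq; rewrite (coset_ofE rh) (coset_adj_side pr).
  by rewrite -(coset_adj_side pq) -(coset_ofE qh) eqxx.
by case: (potential p h); case: (potential r h); case: (potential q h).
Qed.

End CosetTree.

(** * Splitting along two non-adjacent vertices *)

Section Splitting.
Variables (Gamma : labeled_graph) (v w : vertex Gamma).
Hypotheses (vw : v != w) (nE : [set v; w]%SET \notin edges Gamma).
Local Notation G := (artin_group Gamma).
Local Notation g_ := (@artin_gen Gamma).
Implicit Types (u : vertex Gamma) (a b g h : G) (sigma : G -> bool).

Let A : set G := standard_parabolic [set~ v]%SET.
Let B : set G := standard_parabolic [set~ w]%SET.

Let subA : is_subgroup A. Proof. exact: standard_parabolic_subgroup. Qed.
Let subB : is_subgroup B. Proof. exact: standard_parabolic_subgroup. Qed.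

Definition translate g sigma : G -> bool := fun h => sigma (g^-1 * h).
(** Edges are encoded as the cosets of A :&: B, the stabilizer of the edge that
    joins the vertices A and B. *)
Definition base_edge : G -> bool := fun h => `[< A h /\ B h >].
Definition twist sigma : G -> bool := fun h => sigma h (+) base_edge h.

Definition letter u (e : bool) : G := if e then (g_ u)^-1 else g_ u.

(** The generator v is the only one outside A.  It acts affinely, by the
    linear action conjugated by the translation under the base edge. *)
Definition chain_step u e sigma : G -> bool :=
  if u == v then twist (translate (letter u e) (twist sigma))
  else translate (letter u e) sigma.

Lemma translateM g h sigma : translate (g * h) sigma = translate g (translate h sigma).
Proof. by apply/funext => k; rewrite /translate invgM mulgA. Qed.

Lemma translate1 sigma : translate 1 sigma = sigma.
Proof. by apply/funext => k; rewrite /translate invg1 mul1g. Qed.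

Lemma twistK sigma : twist (twist sigma) = sigma.
Proof. by apply/funext => k; rewrite /twist -addbA addbb addbF. Qed.

Lemma letterK u e : letter u e * letter u (~~ e) = 1.
Proof. by case: e; rewrite /= ?mulVg ?mulgV. Qed.

Lemma translate_letterK u e sigma :
  translate (letter u e) (translate (letter u (~~ e)) sigma) = sigma.
Proof. by rewrite -translateM letterK translate1. Qed.

Lemma chain_stepK u e sigma : chain_step u e (chain_step u (~~ e) sigma) = sigma.
Proof.
by rewrite /chain_step; case: eqP => _; rewrite ?twistK translate_letterK ?twistK.
Qed.

Lemma letter_in (X : {set vertex Gamma}) u e : u \in X -> standard_parabolic X (letter u e).
Proof.
move=> uX; have [_ _ SV] := standard_parabolic_subgroup X.
by case: e; [apply: SV|]; exact: standard_parabolic_gen.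
Qed.

Lemma base_edge_translate c : A c -> B c -> translate c base_edge = base_edge.
Proof.
move=> Ac Bc; have [_ AM AV] := subA; have [_ BM BV] := subB.
apply/funext => h; apply: asbool_equiv_eq; split=> -[Ah Bh].
  by split; [have := AM _ _ Ac Ah | have := BM _ _ Bc Bh]; rewrite mulVKg.
by split; [apply: (AM) => //; exact: AV | apply: (BM) => //; exact: BV].
Qed.

Lemma chain_step_A u e sigma : u != v -> chain_step u e sigma = translate (letter u e) sigma.
Proof. by move=> uv; rewrite /chain_step (negPf uv). Qed.

Lemma translate_twist c sigma : A c -> B c ->
  translate c (twist sigma) = twist (translate c sigma).
Proof.
move=> Ac Bc; apply/funext => h; rewrite /twist -[in RHS](base_edge_translate Ac Bc).
by [].
Qed.

(** Generators of both A and B preserve the base edge, so conjugating their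
    action by the translation does not change it. *)
Lemma chain_step_B u e sigma : u != w ->
  chain_step u e sigma = twist (translate (letter u e) (twist sigma)).
Proof.
move=> uw; rewrite /chain_step; case: eqP => // /eqP uv.
by rewrite translate_twist ?twistK //; apply: letter_in; rewrite !inE.
Qed.

Lemma presented_class_letter u e :
  presented_class (@artin_rel Gamma) [:: (u, e)] = letter u e.
Proof. by case: e; rewrite ?presented_class_inv. Qed.

Lemma alternating_fst n (x y : vertex Gamma) r :
  r \in alternating n x y -> r.1 = x \/ r.1 = y.
Proof.
elim: n x y => [//|n IHn] x y /=; rewrite inE => /predU1P[->|/IHn[]]; [left|right|left] => //.
Qed.

Lemma chain_word_A (r : word (vertex Gamma)) sigma : (forall l, l \in r -> l.1 != v) ->
  word_act chain_step r sigma = translate (presented_class (@artin_rel Gamma) r) sigma.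
Proof.
elim: r => [|[u e] r IHr] rv; first by rewrite translate1.
rewrite -cat1s presented_class_cat translateM word_act_cat -IHr; last first.
  by move=> l lr; apply: rv; rewrite inE lr orbT.
by rewrite /= chain_step_A ?presented_class_letter // (rv (u, e)) // inE eqxx.
Qed.

Lemma chain_word_B (r : word (vertex Gamma)) sigma : (forall l, l \in r -> l.1 != w) ->
  word_act chain_step r sigma =
  twist (translate (presented_class (@artin_rel Gamma) r) (twist sigma)).
Proof.
elim: r => [|[u e] r IHr] rv; first by rewrite translate1 twistK.
rewrite -cat1s presented_class_cat translateM word_act_cat IHr; last first.
  by move=> l lr; apply: rv; rewrite inE lr orbT.
by rewrite /= chain_step_B ?presented_class_letter ?twistK // (rv (u, e)) // inE eqxx.
Qed.

(** As v and w are not adjacent, the two generators of a braid relation both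
    differ from v or both differ from w; their words act through the group,
    linearly in the first case and by conjugates in the second one. *)
Lemma chain_step_acts : presents_action (@artin_rel Gamma) setT chain_step.
Proof.
split=> // [u e sigma _|r1 r2]; first exact: chain_stepK.
case=> x [y [Exy -> ->]] sigma _.
set m := label _; have E : presented_class (@artin_rel Gamma) (alternating m x y) =
    presented_class (@artin_rel Gamma) (alternating m y x).
  by apply/presented_classP/word_eq_rel; exists x, y.
have [xyv|] := boolP ((x == v) || (y == v)); last first.
  rewrite negb_or => /andP[xv yv].
  by rewrite !chain_word_A ?E // => l /alternating_fst[]->.
suff /andP[xw yw] : (x != w) && (y != w).
  by rewrite !chain_word_B ?E // => l /alternating_fst[]->.
(* Otherwise {x, y} = {v, w} would be an edge. *)
rewrite -negb_or; apply: contra nE => xyw.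
suff -> : [set v; w]%SET = [set x; y]%SET by [].
case/orP: xyv xyw Exy vw => /eqP-> /orP[]/eqP-> //; rewrite ?eqxx //.
by rewrite finset.setUC.
Qed.

Let chain_act : G -> (G -> bool) -> G -> bool :=
  presented_act (R := @artin_rel Gamma) chain_step.

Let chainM g h sigma : chain_act (g * h) sigma = chain_act g (chain_act h sigma).
Proof. exact: (presented_actM chain_step_acts). Qed.

Let chain1 sigma : chain_act 1 sigma = sigma.
Proof. exact: (presented_act1 chain_step_acts). Qed.

Let chain_gen u sigma : chain_act (g_ u) sigma = chain_step u false sigma.
Proof. exact: (presented_act_gen chain_step_acts). Qed.

Let chain_A a sigma : A a -> chain_act a sigma = translate a sigma.
Proof.
suff H : A `<=` [set a | forall sigma, chain_act a sigma = translate a sigma] by move/H; exact.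
apply: generated_min; first split=> [s|a1 a2 H1 H2 s|a1 H1 s].
- by rewrite chain1 translate1.
- by rewrite chainM H2 H1 translateM.
- rewrite -[s in LHS]translate1 -(mulgV a1) translateM -H1 -chainM mulVg chain1 //.
move=> _ [u uv <-] s /=; rewrite chain_gen chain_step_A //.
by move: uv; rewrite /= !inE.
Qed.

Let chain_B b sigma : B b -> chain_act b sigma = twist (translate b (twist sigma)).
Proof.
suff H : B `<=` [set b | forall sigma, chain_act b sigma = twist (translate b (twist sigma))].
  by move/H; exact.
apply: generated_min; first split=> [s|a1 a2 H1 H2 s|a1 H1 s].
- by rewrite chain1 translate1 twistK.
- by rewrite chainM H2 H1 twistK translateM.
- rewrite -[s in LHS]twistK -[twist s in LHS]translate1 -(mulgV a1) translateM.
  by rewrite -[translate a1^-1 _]twistK -H1 -chainM mulVg chain1 !twistK.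
move=> _ [u uv <-] s /=; rewrite chain_gen chain_step_B //.
by move: uv; rewrite /= !inE.
Qed.

Let chainD g (sigma rho : G -> bool) :
  chain_act g (fun h => sigma h (+) rho h) =
  (fun h => chain_act g sigma h (+) translate g rho h).
Proof.
rewrite -[g in translate g](@presented_reprK _ (@artin_rel Gamma)) /chain_act /presented_act.
elim: (repr g) => [|[u e] r IHr] /=; first by rewrite translate1.
rewrite IHr -cat1s presented_class_cat translateM presented_class_letter /chain_step.
case: eqP => _; apply/funext => h; rewrite /twist /translate //.
by rewrite -!addbA; congr (_ (+) _); rewrite addbC -addbA.
Qed.

(** The chain of edges of a path from the vertex A to the coset of g: it is
    empty at A and equal to the base edge at B, and both initial values are
    invariant under the respective subgroup. *)
Definition splitting_potential (s : bool) g : G -> bool :=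
  chain_act g (if s then base_edge else fun=> false).

Lemma splitting_potential_coset s g k : side_group A B s k ->
  splitting_potential s (g * k) = splitting_potential s g.
Proof.
rewrite /splitting_potential chainM; case: s => /= Sk; congr chain_act.
  by rewrite chain_B //; apply/funext => h; rewrite /twist /translate !addbb.
by rewrite chain_A.
Qed.

Lemma splitting_potential_edge g h :
  splitting_potential false g h (+) splitting_potential true g h =
  `[< A (g^-1 * h) /\ B (g^-1 * h) >].
Proof.
rewrite /splitting_potential.
have -> : base_edge = (fun h => false (+) base_edge h) by [].
by rewrite chainD addbA addbb.
Qed.

Lemma splitting_generate (K : set G) : is_subgroup K -> A `<=` K -> B `<=` K ->
  forall g, K g.
Proof.
move=> subK AK BK; apply: (@presented_ind _ (@artin_rel Gamma)) => // u.
have [uv|uv] := eqVneq u v; [apply: BK | apply: AK];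
  by apply: standard_parabolic_gen; rewrite !inE // uv.
Qed.

Definition splitting_tree_adj := @coset_adj G A B.
Definition splitting_act := @coset_act G A B.

Let cuts := coset_cuts subA subB splitting_potential_coset splitting_potential_edge.
Let connected := coset_connected subA subB splitting_generate.

Lemma splitting_tree : is_tree splitting_tree_adj.
Proof.
apply: (@cut_tree _ _ (@coset_side G A B)).
- exact: coset_adj_sym.
- exact: coset_adj_side.
- exact: connected.
- exact: cuts.
by constructor; exact: (coset_of A B false 1).
Qed.

(** On the base edge v fixes B and moves A, whereas w fixes A and moves B. *)
Lemma splitting_product_hyperbolic p : splitting_act (g_ v * g_ w) p <> p.
Proof.
pose xs i := coset_of A B (i == 0)%N 1.
have fixE s g : splitting_act g (coset_of A B s 1) = coset_of A B s 1 <-> side_group A B s g.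
  by have := coset_act_fix subA subB g s 1; rewrite conjs1.
apply: (elliptic_product_hyperbolic (@coset_adj_sym G A B) (@coset_adj_side G A B)
  connected cuts (coset_act_simplicial A B) (n := 1%N) (xs := xs)) => //.
- by case=> // _; rewrite coset_adj_sym coset_adj_of.
- by apply/fixE; apply: standard_parabolic_gen; rewrite !inE.
- by apply/eqP => /fixE; apply: standard_parabolic_notin; rewrite !inE eqxx.
- by apply/fixE; apply: standard_parabolic_gen; rewrite !inE eq_sym.
- by apply/eqP => /fixE; apply: standard_parabolic_notin; rewrite !inE eqxx.
Qed.

Lemma splitting_stabilizer p : parabolic [set g | splitting_act g p = p].
Proof.
have [k ->] := coset_vertexP p; set s := coset_side p.
have -> : [set g | splitting_act g (coset_of A B s k) = coset_of A B s k] =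
    conjs k (side_group A B s).
  by apply/seteqP; split=> g /(coset_act_fix subA subB).
by case: s; exists k; eexists.
Qed.

(** H acts through its inclusion, and without inversion since sides are
    preserved; so all its elements are elliptic. *)
Lemma FA'_finite_fixpoint (H : groupClosed G) (F : seq G) :
  FA' (subgroup H) -> (forall x, x \in F -> x \in H) ->
  exists p, forall x, x \in F -> splitting_act x p = p.
Proof.
move=> FAH FH; have [act1 actM act_adj] := coset_act_simplicial A B.
pose act (h : subgroup H) := splitting_act (val h).
have act_simp : simplicial_action splitting_tree_adj act.
  split=> [x|g h x|g x y]; [exact: act1 | exact: actM | exact: act_adj].
have ell : locally_elliptic act.
  apply: FAH splitting_tree act_simp _.
  by move=> g x y; exact: coset_act_inversion.
have [p Fp] := finite_elliptic_fixpoint (@coset_adj_sym G A B) (@coset_adj_side G A B)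
  connected cuts act_simp (coset_of A B false 1) (pmap insub F) ell.
exists p => x Fx; have Hx := FH x Fx.
by apply: (Fp (Sub x Hx)); rewrite mem_pmap_sub SubK.
Qed.

End Splitting.

Theorem proposition1p3 (Gamma : labeled_graph)
    (H : groupClosed (artin_group Gamma))
    (classA : parabolic_intersection Gamma) (FAH : FA' (subgroup H)) :
  exists2 P : set (artin_group Gamma), complete_parabolic P & [set` H] `<=` P.
Proof.
have [a [X [HP _ minP]]] := parabolic_closure classA [set` H].
exists (conjs a (standard_parabolic X)) => //; exists a, X; split=> // v w vX wX vw.
apply: contrapT => /negP nE.
have [F [FH clF]] := finite_parabolic_closure classA [set` H].
have [p Fp] := FA'_finite_fixpoint vw nE FAH FH.
have pQ := splitting_stabilizer p.
have XQ := minP _ pQ (clF _ pQ Fp).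
have [act1 actM _] := coset_act_simplicial
  (standard_parabolic [set~ v]%SET) (standard_parabolic [set~ w]%SET).
apply: (@splitting_product_hyperbolic _ v w vw nE (splitting_act a^-1 p)).
have -> : forall g, splitting_act g (splitting_act a^-1 p) =
  splitting_act a^-1 (splitting_act (a * g * a^-1) p).
  by move=> g; rewrite /splitting_act -!actM !mulgA mulVg mul1g.
congr splitting_act; apply: XQ; exists (artin_gen v * artin_gen w) => //.
have [_ SM _] := standard_parabolic_subgroup X.
by apply: SM; exact: standard_parabolic_gen.
Qed.
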